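(* In the ring of formal power series in the variables $x=(x_1,x_2,\dots)$ with coefficients polynomial in the indeterminates $a,b,t$, the following identity holds: \[ \sum_{\lambda} a^{l(\lambda_{\mathrm{o}})}\, h_{\lambda_{\mathrm{e}}}(ab;t)\,h_{\lambda_{\mathrm{o}}}(b/a;t)\,P_{\lambda}(x;t) =\prod_{i\geq 1}\frac{(1+ax_i)(1+bx_i)}{(1-x_i)(1+x_i)}\prod_{i<j}\frac{1-tx_ix_j}{1-x_ix_j}, \] where the sum is over all partitions $\lambda$.
   Context: $P_\lambda(x;t)$ denotes the Hall–Littlewood symmetric function indexed by the partition $\lambda$ (so $P_\lambda(x;0)=s_\lambda(x)$ is the Schur function and $P_\lambda(x;1)=m_\lambda(x)$ the monomial symmetric function). For a partition $\lambda$, $l(\lambda)$ is its number of nonzero parts and $m_i(\lambda)$ the multiplicity of the part $i$. $\lambda_{\mathrm{e}}$ (resp. $\lambda_{\mathrm{o}}$) is the partition formed by the even (resp. odd) parts of $\lambda$; e.g. for $\lambda=(4,3,3,2,1,1,1)$, $\lambda_{\mathrm{e}}=(4,2)$, $\lambda_{\mathrm{o}}=(3,3,1,1,1)$. The Rogers–Szegő polynomial is $H_m(z;t)=\sum_{i=0}^m z^i \binom{m}{i}_t$, where $\binom{m}{i}_t=\frac{(t;t)_m}{(t;t)_i(t;t)_{m-i}}$ for $0\le i\le m$ is the $t$-binomial coefficient and $(t;t)_n=\prod_{k=1}^n(1-t^k)$. For a partition $\lambda$, $h_\lambda(z;t)=\prod_{i\ge1}H_{m_i(\lambda)}(z;t)$.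 (Note $a^{l(\lambda_{\mathrm{o}})}h_{\lambda_{\mathrm{o}}}(b/a;t)$ is a polynomial in $a,b$.) *)

(* Defs.v *)
From HB Require Import structures.
From mathcomp Require Import all_boot all_order all_algebra all_fingroup.
From mathcomp Require Import fraction finmap multiset mpoly.
From mathcomp Require Import boolp classical_sets.

Set Implicit Arguments.
Unset Strict Implicit.
Unset Printing Implicit Defensive.

Import GRing.Theory.
Local Open Scope ring_scope.

(** * Formal power series in countably many variables

   The variables x_1, x_2, ... of the literature are indexed from 0 here.  A
   monomial is the finite multiset of the indices of its variables, so [m i] is
   the exponent of the i-th variable, [mset0] is the monomial 1, and [`+`],
   [`<=`], [`\`] are the product, the divisibility and the quotient. *)

Notation monom := ({mset nat}%mset).

Definition mon_divisors (m : monom) : {fset monom} :=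
  [fset seq_mset (mask (val b) (enum_mset m)) | b : (size m).-tuple bool]%fset.

Lemma mon_divisorsP (m k : monom) : (k \in mon_divisors m) = (k `<=` m)%mset.
Proof.
have cE (u : monom) x : u x = count_mem x u.
  by rewrite -{1}[u]seq_mset_id mset_seqE.
apply/imfsetP/msubsetP => /= [[b _ ->] x|sub_km].
  rewrite mset_seqE cE.
  by rewrite leq_count_mask.
have /count_subseqP[s /subseqP[b sb def_s] kE]:
    forall x, (count_mem x k <= count_mem x m)%N.
  by move=> x; rewrite -!cE.
exists (tcast sb (in_tuple b)) => //=.
by rewrite val_tcast /= -def_s -[LHS]seq_mset_id; apply/eq_seq_msetP.
Qed.

Lemma size_msetD (m k : monom) : size (m `+` k)%mset = (size m + size k)%N.
Proof.
rewrite -size_cat; apply: perm_size; apply/eq_seq_msetP/msetP => x.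
by rewrite seq_mset_id mset_seqE count_cat msetE2 -!mset_seqE !seq_mset_id.
Qed.

Definition fps (R : Type) := monom -> R.

Section FpsZmod.
Variable R : zmodType.
Implicit Types f g h : fps R.

HB.instance Definition _ := gen_eqMixin (fps R).
HB.instance Definition _ := gen_choiceMixin (fps R).

Definition fps_zero : fps R := fun=> 0.
Definition fps_opp f : fps R := fun m => - f m.
Definition fps_add f g : fps R := fun m => f m + g m.

Lemma fps_addA : associative fps_add.
Proof. by move=> f g h; apply/funext => m; rewrite /fps_add addrA. Qed.
Lemma fps_addC : commutative fps_add.
Proof. by move=> f g; apply/funext => m; rewrite /fps_add addrC. Qed.
Lemma fps_add0 : left_id fps_zero fps_add.
Proof. by move=> f; apply/funext => m; rewrite /fps_add add0r. Qed.
Lemma fps_addN : left_inverse fps_zero fps_opp fps_add.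
Proof. by move=> f; apply/funext => m; rewrite /fps_add addNr. Qed.

HB.instance Definition _ :=
  GRing.isZmodule.Build (fps R) fps_addA fps_addC fps_add0 fps_addN.

Lemma fps0E m : (0 : fps R) m = 0. Proof. by []. Qed.
Lemma fpsDE f g m : (f + g) m = f m + g m. Proof. by []. Qed.
Lemma fpsNE f m : (- f) m = - f m. Proof. by []. Qed.
Lemma fps_sumE I (r : seq I) P (F : I -> fps R) m :
  (\sum_(i <- r | P i) F i) m = \sum_(i <- r | P i) F i m.
Proof. by elim/big_rec2: _ => // i y1 y2 _ <-. Qed.

End FpsZmod.

Section FpsRing.
Variable R : comNzRingType.
Implicit Types f g h : fps R.

Definition fps_one : fps R := fun m => (m == mset0)%:R.
Definition fps_mul f g : fps R :=
  fun m => \sum_(k <- mon_divisors m) f k * g (m `\` k)%mset.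
Definition fps_scale (c : R) f : fps R := fun m => c * f m.

Lemma fps_mulC : commutative fps_mul.
Proof.
move=> f g; apply/funext => m; rewrite /fps_mul.
have pm: perm_eq (mon_divisors m) [seq (m `\` k)%mset | k <- mon_divisors m].
  apply: uniq_perm; first exact: fset_uniq.
    rewrite map_inj_in_uniq ?fset_uniq // => k l.
    by rewrite !mon_divisorsP => /msetBBK {2}<- /msetBBK {2}<- ->.
  move=> k; apply/idP/mapP => [|[l _ ->]]; rewrite mon_divisorsP ?msubsetDl //.
  move=> le_km; exists (m `\` k)%mset; last by rewrite msetBBK.
  by rewrite mon_divisorsP msubsetDl.
rewrite (perm_big _ pm) big_map big_seq [RHS]big_seq; apply: eq_bigr => k.
by rewrite mon_divisorsP => /msetBBK ->; rewrite mulrC.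
Qed.

Lemma sum_mon_divisors_chain (F : monom -> monom -> R) m :
  \sum_(k <- mon_divisors m) \sum_(l <- mon_divisors k) F l k =
  \sum_(l <- mon_divisors m) \sum_(j <- mon_divisors (m `\` l)%mset)
    F l (l `+` j)%mset.
Proof.
transitivity (\sum_(k <- mon_divisors m)
    \sum_(l <- mon_divisors m | (l `<=` k)%mset) F l k).
  rewrite big_seq [RHS]big_seq; apply: eq_bigr => k; rewrite mon_divisorsP => km.
  rewrite -[RHS]big_filter; apply: perm_big; apply: uniq_perm.
  - exact: fset_uniq.
  - by rewrite filter_uniq // fset_uniq.
  move=> l; rewrite mem_filter !mon_divisorsP andb_idr // => lk.
  exact: msubset_trans lk km.
rewrite (exchange_big_dep xpredT) //=.
rewrite big_seq [RHS]big_seq; apply: eq_bigr => l; rewrite mon_divisorsP => lm.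
rewrite -big_filter -(big_map (fun j => l `+` j)%mset xpredT (F l)) /=.
apply: perm_big; apply: uniq_perm.
- by rewrite filter_uniq // fset_uniq.
- rewrite map_inj_uniq ?fset_uniq // => j1 j2 /(congr1 (fun u => u `\` l)%mset).
  by rewrite !msetDKB.
move=> k; rewrite mem_filter mon_divisorsP; apply/andP/mapP.
  case=> lk km; exists (k `\` l)%mset; last by rewrite msetBDKC.
  by rewrite mon_divisorsP msetSB.
case=> j; rewrite mon_divisorsP => jm ->; split.
  by apply/msubsetP => x; rewrite msetE2 leq_addr.
by rewrite -(msetBDKC lm) msetDS.
Qed.

Lemma fps_mulA : associative fps_mul.
Proof.
move=> f g h; apply/funext => m; rewrite /fps_mul.
pose F l k := f l * g (k `\` l)%mset * h (m `\` k)%mset.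
transitivity (\sum_(k <- mon_divisors m) \sum_(l <- mon_divisors k) F l k);
  last by apply: eq_bigr => k _; rewrite mulr_suml.
rewrite sum_mon_divisors_chain; apply: eq_bigr => l _.
rewrite mulr_sumr; apply: eq_bigr => j _.
by rewrite /F mulrA msetDKB msetBDA.
Qed.

Lemma fps_mul1 : left_id fps_one fps_mul.
Proof.
move=> f; apply/funext => m; rewrite /fps_mul.
rewrite (big_rem mset0) /=; last by rewrite mon_divisorsP msub0set.
rewrite /fps_one eqxx mul1r msetB0 big_seq big1 ?addr0 // => k.
by rewrite mem_rem_uniq ?fset_uniq // inE => /andP[/negPf-> _]; rewrite mul0r.
Qed.

Lemma fps_mulDl : left_distributive fps_mul (@fps_add R).
Proof.
move=> f g h; apply/funext => m; rewrite /fps_mul /fps_add -big_split /=.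
by apply: eq_bigr => k _; rewrite mulrDl.
Qed.

Lemma fps_oner_neq0 : fps_one != 0.
Proof.
apply/eqP => /(congr1 (fun f : fps R => f mset0)) /eqP.
by rewrite /fps_one eqxx fps0E oner_eq0.
Qed.

HB.instance Definition _ := GRing.Zmodule_isComNzRing.Build (fps R)
  fps_mulA fps_mulC fps_mul1 fps_mulDl fps_oner_neq0.

Lemma fps1E m : (1 : fps R) m = (m == mset0)%:R. Proof. by []. Qed.
Lemma fpsME f g m :
  (f * g) m = \sum_(k <- mon_divisors m) f k * g (m `\` k)%mset.
Proof. by []. Qed.

Lemma fps_scaleA c d f : fps_scale c (fps_scale d f) = fps_scale (c * d) f.
Proof. by apply/funext => m; rewrite /fps_scale mulrA. Qed.
Lemma fps_scale1 : left_id 1 fps_scale.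
Proof. by move=> f; apply/funext => m; rewrite /fps_scale mul1r. Qed.
Lemma fps_scaleDr : right_distributive fps_scale +%R.
Proof. by move=> c f g; apply/funext => m; rewrite /fps_scale mulrDr. Qed.
Lemma fps_scaleDl f : {morph fps_scale^~ f : c d / c + d}.
Proof. by move=> c d; apply/funext => m; rewrite /fps_scale mulrDl. Qed.

HB.instance Definition _ := GRing.Zmodule_isLmodule.Build R (fps R)
  fps_scaleA fps_scale1 fps_scaleDr fps_scaleDl.

Lemma fpsZE c f m : (c *: f) m = c * f m. Proof. by []. Qed.

Lemma fps_scaleAl c f g : c *: (f * g) = c *: f * g.
Proof.
apply/funext => m; rewrite fpsZE !fpsME mulr_sumr.
by apply: eq_bigr => k _; rewrite mulrA.
Qed.

HB.instance Definition _ :=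
  GRing.Lmodule_isLalgebra.Build R (fps R) fps_scaleAl.

Definition fpsX (i : nat) : fps R := fun m => (m == [mset i]%mset)%:R.

End FpsRing.

(* The inverse is unique when it exists, so choosing one loses nothing; see
   [fps_unitE] for the units. *)
Section FpsUnitRing.
Variable R : comUnitRingType.
Implicit Types f g h : fps R.

Definition fps_unit : pred (fps R) := fun f => `[< exists g, g * f = 1 >].
Definition fps_inv f : fps R := xget f [set g | g * f = 1]%classic.

Lemma fps_mulVr : {in fps_unit, left_inverse 1 fps_inv *%R}.
Proof. by move=> f /asboolP[g gf]; rewrite /fps_inv; case: xgetP => [h _ //|/(_ g)]. Qed.
Lemma fps_unitPl f g : g * f = 1 -> fps_unit f.
Proof. by move=> gf; apply/asboolP; exists g. Qed.
Lemma fps_inv_out : {in [predC fps_unit], fps_inv =1 id}.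
Proof.
move=> f /asboolPn nf; rewrite /fps_inv; case: xgetP => // g _ gf.
by case: nf; exists g.
Qed.

HB.instance Definition _ := GRing.ComNzRing_hasMulInverse.Build (fps R)
  fps_mulVr fps_unitPl fps_inv_out.

Lemma fpsM0E f g : (f * g) mset0 = f mset0 * g mset0.
Proof.
rewrite fpsME (big_rem mset0) /=; last by rewrite mon_divisorsP msub0set.
rewrite msetB0 big_seq big1 ?addr0 // => k.
by rewrite mem_rem_uniq ?fset_uniq // inE mon_divisorsP msubset0 => /andP[/negPf->].
Qed.

Lemma fps_unitE f : (f \is a GRing.unit) = (f mset0 \is a GRing.unit).
Proof.
apply/idP/idP => [uf|uf0].
  have := congr1 (fun h : fps R => h mset0) (mulVr uf).
  rewrite /= fpsM0E fps1E eqxx => vf; apply/unitrPr; exists (f^-1 mset0).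
  by rewrite mulrC.
pose g : fps R := 1 - (f mset0)^-1 *: f.
have g0: g mset0 = 0.
  by rewrite /g fpsDE fpsNE fpsZE fps1E eqxx mulVr // subrr.
have gX n (m : monom) : (size m < n)%N -> (g ^+ n) m = 0.
  elim: n m => // n IHn m lt_mn; rewrite exprS fpsME big_seq big1 // => k.
  rewrite mon_divisorsP => km; case: (eqVneq k mset0) => [->|k0].
    by rewrite g0 mul0r.
  rewrite IHn ?mulr0 //; apply: leq_trans (_ : (size m <= n)%N); last by [].
  rewrite -{2}(msetBDKC km) size_msetD -[X in (X < _)%N]add0n ltn_add2r.
  by rewrite lt0n size_mset_eq0.
pose h : fps R := fun m => (\sum_(i < (size m).+1) g ^+ i) m.
suff hf: h * (1 - g) = 1.
  have: (h * (f mset0)^-1%:A) * f = 1.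
    by rewrite -mulrA mulr_algl -[RHS]hf /g opprB addrC subrK.
  by move=> e; apply/unitrPr; eexists; rewrite mulrC; exact: e.
apply/funext => m; pose N := (size m).+1.
transitivity (((\sum_(i < N) g ^+ i) * (1 - g)) m).
  rewrite !fpsME big_seq [RHS]big_seq; apply: eq_bigr => k.
  rewrite mon_divisorsP => km; congr (_ * _); rewrite /h !fps_sumE.
  have le_km: (size (k : monom) <= size m)%N by rewrite -(msetBDKC km) size_msetD leq_addr.
  rewrite (big_ord_widen N (fun i => (g ^+ i) k)) ?ltnS // big_mkcond /=.
  by apply: eq_bigr => i _; case: ltnP => // /gX ->.
rewrite mulrC -opprB mulNr -subrX1 opprB fpsDE fpsNE gX ?subr0 //.
Qed.

End FpsUnitRing.

(** * Infinite sums and products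

   Unconditional convergence, for the topology of coefficientwise (eventually
   stationary) convergence. *)

Definition has_sum (R : zmodType) (I : choiceType) (F : I -> fps R) (S : fps R) :=
  forall m : monom, exists A : {fset I},
    forall B : {fset I}, (A `<=` B)%fset -> (\sum_(i <- B) F i) m = S m.

Definition has_prod (R : comNzRingType) (I : choiceType) (F : I -> fps R)
    (S : fps R) :=
  forall m : monom, exists A : {fset I},
    forall B : {fset I}, (A `<=` B)%fset -> (\prod_(i <- B) F i) m = S m.

(** * Partitions *)

Definition is_intpart (s : seq nat) := sorted geq s && (0%N \notin s).
Definition intpart := {s : seq nat | is_intpart s}.

Definition even_parts (s : seq nat) := [seq i <- s | ~~ odd i].
Definition odd_parts (s : seq nat) := [seq i <- s | odd i].

(** * Hall-Littlewood symmetric functions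

   In n variables, with lambda = (lambda_1, ..., lambda_n) padded by zeros,
     P_lambda(x_1, ..., x_n; t) =
       \sum_(w in S_n / S_n^lambda)
         w (x^lambda \prod_(lambda_i > lambda_j) (x_i - t x_j) / (x_i - x_j)),
   S_n^lambda being the stabiliser of lambda, and P_lambda = 0 if
   n < l(lambda).  No division by a polynomial in t is involved, so that t may
   be any element of the coefficient ring. *)

Section HallLittlewood.
Variables (R : idomainType) (n : nat) (la : seq nat) (t : R).

Local Notation ratx i := (tofrac ('X_i : {mpoly R[n]})).
Local Notation ratt := (tofrac (t%:MP : {mpoly R[n]})).
Local Notation part i := (nth 0%N la i).

Definition hl_term (w : 'S_n) : {fraction {mpoly R[n]}} :=
  (\prod_(i < n) ratx (w i) ^+ part i) *
  \prod_(i < n) \prod_(j < n | (part j < part i)%N)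
     ((ratx (w i) - ratt * ratx (w j)) / (ratx (w i) - ratx (w j))).

Definition hl_stab : {set 'S_n} := [set w : 'S_n | [forall i, part (w i) == part i]].

(* In MathComp [(u * w) i = w (u i)], hence the left cosets of the literature
   are right cosets here. *)
Lemma hl_term_coset (u w : 'S_n) : u \in hl_stab -> hl_term (u * w)%g = hl_term w.
Proof.
rewrite inE => /forallP /= uP; rewrite /hl_term; congr (_ * _).
  rewrite [RHS](reindex_inj (@perm_inj _ u)) /=.
  by apply: eq_bigr => i _; rewrite permM (eqP (uP i)).
rewrite [RHS](reindex_inj (@perm_inj _ u)) /=; apply: eq_bigr => i _.
rewrite [RHS](reindex_inj (@perm_inj _ u)) /=; apply: eq_big => j.
  by rewrite (eqP (uP i)) (eqP (uP j)).
by rewrite !permM.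
Qed.

Definition hl_rat : {fraction {mpoly R[n]}} :=
  if (size la <= n)%N then
    \sum_(C in rcosets hl_stab [set: 'S_n]) hl_term (repr C)
  else 0.

(* [hl_rat] is a polynomial, this is that polynomial. *)
Definition hl_poly : {mpoly R[n]} :=
  xget 0 [set p : {mpoly R[n]} | tofrac p = hl_rat]%classic.

End HallLittlewood.

Definition mon_width (m : monom) : nat := \max_(i <- enum_mset m) i.+1.

(* P_lambda(x; t) restricts to P_lambda(x_1, ..., x_n; t) when the variables
   after x_n are set to 0, so that its coefficient at a monomial in x_1, ..., x_n
   is read off there; [mon_width m] is the least n that is suitable for m. *)
Definition HallLittlewoodP (R : idomainType) (la : seq nat) (t : R) : fps R :=
  fun m => (hl_poly (mon_width m) la t)@_[multinom (m : monom) (val i) | i < mon_width m].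

(** * Rogers-Szego polynomials *)

Section RogersSzego.
Variable F : fieldType.
Implicit Types z t : F.

Definition tpoch t n := \prod_(1 <= k < n.+1) (1 - t ^+ k).
Definition tbinom t m i := tpoch t m / (tpoch t i * tpoch t (m - i)).
Definition RogersSzegoH m z t := \sum_(i < m.+1) z ^+ i * tbinom t m i.

(* The parts that do not occur contribute the factor H_0 = 1. *)
Definition RogersSzegoh (la : seq nat) z t :=
  \prod_(i <- undup la) RogersSzegoH (count_mem i la) z t.

End RogersSzego.

(** * The coefficient ring Z[a, b, t] *)

Notation Zabt := {mpoly int[3]}.

Definition va : Zabt := 'X_(@Ordinal 3 0 isT).
Definition vb : Zabt := 'X_(@Ordinal 3 1 isT).
Definition vt : Zabt := 'X_(@Ordinal 3 2 isT).

(* Main.v *)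
(* P_lambda(x_1, ..., x_n; t) is the sum, over the maps f : [n] -> N whose nonzero
   values form lambda, of x^f \prod_(f i > f j) (x_i - t x_j) / (x_i - x_j).
   Splitting off the level sets of f one after the other turns a weighted sum over
   all f into an alternating product of two operators on functions of subsets of [n]:
     (L_w phi)(U) = \sum_(I <= U) w(|U \ I|) psi(I, U \ I) phi(I)
   with psi(A, B) = \prod_(i in A, j in B) (x_i - t x_j) / (x_i - x_j), and the
   multiplication X by \prod_(i in U) x_i.

   For a = b = 0 only even values of f occur, and the identity says that
     Phi(U) = \prod_(i in U) 1 / (1 - x_i^2)
              \prod_(i < j in U) (1 - t x_i x_j) / (1 - x_i x_j)
   is a fixed point of L_1 X^2, an identity of rational functions obtained by
   interpolation in one variable.  Multiplication by Y_b = \prod (1 + b x_i) satisfies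
   Y_b L_c X = L_c X L_(bc) Y_b, where L_c has the weights c^m (Pieri rule).  Moving
   Y_a and Y_b through (L_1 X^2)^k therefore gives L_1 X (L_a L_b) X (L_(ab) L_1) X ...,
   and L_al L_be has the weights \sum_k al^(m-k) be^k binom(m, k)_t: the
   Rogers-Szego polynomials at ab on the even levels and at b/a on the odd ones.

   The coefficient of a monomial in x_1, ..., x_n only involves the first n variables
   and finitely many f, so that congruences modulo high order suffice. *)

Require Import Defs.
From HB Require Import structures.
From mathcomp Require Import all_boot all_order all_algebra all_fingroup.
From mathcomp Require Import fraction finmap multiset mpoly.
From mathcomp Require Import ring.
From mathcomp Require boolp classical_sets.

Set Implicit Arguments.
Unset Strict Implicit.
Unset Printing Implicit Defensive.

Import GRing.Theory.
Local Open Scope ring_scope.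

(** * Sums over subsets *)

Section Subsets.
Variable T : finType.
Implicit Types (i j k : T) (A B U V : {set T}).

Lemma subsetU1_notin i V A : i \notin V -> i \notin A ->
  (A \subset i |: V) = (A \subset V).
Proof.
move=> iV iA; apply/subsetP/subsetP => h j jA.
  have := h j jA; rewrite in_setU1; case: eqVneq jA => // -> jA.
  by rewrite jA in iA.
by rewrite in_setU1 h ?orbT.
Qed.

Lemma notin_subset i V A : i \notin V -> A \subset V -> i \notin A.
Proof. by move=> iV /subsetP AV; apply: contra iV => /AV. Qed.

Lemma setU1D i V A : i \notin V -> A \subset V -> (i |: V) :\: A = i |: (V :\: A).
Proof.
move=> iV AV; apply/setP => j; rewrite !inE; case: eqVneq => [->|] //=.
by rewrite (notin_subset iV AV).
Qed.

Lemma setU1DU1 i V A : i \notin V -> (i |: V) :\: (i |: A) = V :\: A.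
Proof.
move=> iV; apply/setP => j; rewrite !inE; case: eqVneq => [->|] //=.
by rewrite (negPf iV) andbF.
Qed.

Lemma notin_setD i V A : i \notin V -> i \notin V :\: A.
Proof. by move=> iV; rewrite inE (negPf iV) andbF. Qed.

Lemma sum_subsetU1 (M : nmodType) i V (F : {set T} -> M) : i \notin V ->
  \sum_(A : {set T} | A \subset i |: V) F A =
  \sum_(A : {set T} | A \subset V) (F A + F (i |: A)).
Proof.
move=> iV; rewrite big_split /= (bigID (fun A : {set T} => i \in A)) /= addrC.
congr (_ + _).
  apply: eq_bigl => A; case: (boolP (i \in A)) => iA; rewrite ?andbF ?andbT.
    by apply/esym/negbTE; apply: contraL iA => /notin_subset->.
  exact: subsetU1_notin.
rewrite (reindex_onto (fun A => i |: A) (fun A => A :\ i)) /=; last first.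
  by move=> A /andP[_ iA]; rewrite setD1K.
apply: eq_bigl => A; rewrite setU11 andbT.
apply/andP/idP => [[AV /eqP Ai]|AV]; last first.
  by rewrite setUS // setU1K // (notin_subset iV AV).
have iA : i \notin A by rewrite -Ai !inE eqxx.
by rewrite -(subsetU1_notin iV iA) (subset_trans (subsetUr _ _) AV).
Qed.

Lemma big_setD_subset (R : Type) (idx : R) (op : Monoid.com_law idx) V A (F : T -> R) :
  A \subset V ->
  \big[op/idx]_(j in V) F j =
  op (\big[op/idx]_(j in A) F j) (\big[op/idx]_(j in V :\: A) F j).
Proof.
by move=> /setIidPr AV; rewrite (big_setID A) /= AV.
Qed.

Lemma big_setU_disjoint (R : Type) (idx : R) (op : Monoid.com_law idx) A B (F : T -> R) :
  [disjoint A & B] ->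
  \big[op/idx]_(j in A :|: B) F j =
  op (\big[op/idx]_(j in A) F j) (\big[op/idx]_(j in B) F j).
Proof.
by move=> d; rewrite -bigU //; apply: eq_bigl => j; rewrite !inE.
Qed.

End Subsets.

(** * Interpolation in one variable *)

Section TopCoef.
Variable R : comNzRingType.
Implicit Types (p q : {poly R}) (c : R).

(** A degree bound together with the coefficient at that bound. The value [c] may be 0, and then
    [top_coef0] improves the bound. *)
Definition top_coef p d c := (size p <= d.+1)%N /\ p`_d = c.

Lemma top_coefD p q d c c' : top_coef p d c -> top_coef q d c' -> top_coef (p + q) d (c + c').
Proof.
move=> [sp <-] [sq <-]; split; last by rewrite coefD.
by rewrite (leq_trans (size_polyD _ _)) // geq_max sp sq.
Qed.

Lemma top_coefZ p d c a : top_coef p d c -> top_coef (a *: p) d (a * c).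
Proof.
by move=> [sp <-]; split; [exact: leq_trans (size_scale_leq _ _) sp | rewrite coefZ].
Qed.

Lemma top_coefM p q d e c c' : top_coef p d c -> top_coef q e c' -> top_coef (p * q) (d + e) (c * c').
Proof.
move=> [sp <-] [sq <-]; split.
  apply: leq_trans (size_polyMleq _ _) _.
  by rewrite -subn1 leq_subLR add1n -addnS -addSn leq_add.
rewrite coefM.
have dlt : (d < (d + e).+1)%N by rewrite ltnS leq_addr.
rewrite (bigD1 (Ordinal dlt)) //= addKn big1 ?addr0 // => i ni.
have := ltn_ord i; rewrite ltnS => ile.
case: (ltngtP i d) => [lt|gt|eq].
- rewrite [q`__]nth_default ?mulr0 //; apply: leq_trans sq _.
  by rewrite ltn_subRL ltn_add2r.
- by rewrite nth_default ?mul0r //; apply: leq_trans sp _.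
- by case/eqP: ni; apply: val_inj.
Qed.

Lemma top_coefC c : top_coef c%:P 0 c.
Proof. by split; rewrite ?coefC // size_polyC_leq1. Qed.

Lemma top_coef1 : top_coef 1 0 1.
Proof. exact: (top_coefC 1). Qed.

Lemma top_coef_sum (I : finType) (P : pred I) (F : I -> {poly R}) d (c : I -> R) :
  (forall i, P i -> top_coef (F i) d (c i)) ->
  top_coef (\sum_(i | P i) F i) d (\sum_(i | P i) c i).
Proof.
move=> h; elim/big_rec2: _ => [|i y p Pi IH]; last exact/top_coefD/IH/h.
by split; rewrite ?size_poly0 ?coef0.
Qed.

Lemma top_coef_linear a b : top_coef (a *: 'X - b%:P) 1 a.
Proof.
split; last by rewrite coefB coefZ coefX coefC subr0 mulr1.
rewrite (leq_trans (size_polyD _ _)) // geq_max size_polyN.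
rewrite (leq_trans (size_scale_leq _ _)) ?size_polyX //.
by rewrite (leq_trans (size_polyC_leq1 _)).
Qed.

Lemma top_coef_prod (T : finType) (V : {set T}) (a : T -> R) (b : T -> R) :
  top_coef (\prod_(i in V) (a i *: 'X - (b i)%:P)) #|V| (\prod_(i in V) a i).
Proof.
have [n] := ubnP #|V|; elim: n V => // n IH V; case: (set_0Vmem V) => [-> _|[i iV]].
  by rewrite !big_set0 cards0; apply: top_coef1.
rewrite ltnS => Vn; rewrite !(big_setD1 _ iV) /= (cardsD1 i V) iV.
apply: top_coefM; first exact: top_coef_linear.
by apply: IH; rewrite (cardsD1 i V) iV in Vn.
Qed.

Lemma top_coefW p d c : top_coef p d c -> top_coef p d.+1 0.
Proof. by move=> [sp _]; split; [exact: leqW | rewrite nth_default]. Qed.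

Lemma top_coef0 p d : top_coef p d.+1 0 -> (size p <= d.+1)%N.
Proof.
case=> sp p0; rewrite leqNgt; apply/negP => sp'.
have /eqP sz : size p == d.+2 by rewrite eqn_leq sp sp'.
have : lead_coef p == 0 by rewrite lead_coefE sz /= p0.
by rewrite lead_coef_eq0 => /eqP p00; rewrite p00 size_poly0 in sz.
Qed.

End TopCoef.

Section Psi.
Variables (K : fieldType) (T : finType) (t : K) (x : T -> K).
Hypothesis x_inj : injective x.
Implicit Types (i j k : T) (A B U V : {set T}).

Definition psi A B := \prod_(i in A) \prod_(j in B) ((x i - t * x j) / (x i - x j)).

Lemma x_sub_neq0 i j : i != j -> x i - x j != 0.
Proof. by rewrite subr_eq0 (inj_eq x_inj). Qed.

Lemma x_sub_neq0_in i j A : i \notin A -> j \in A -> x i - x j != 0.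
Proof. by move=> iA jA; apply: x_sub_neq0; apply: contraNneq iA => ->. Qed.

Lemma psi0l B : psi set0 B = 1.
Proof. by rewrite /psi big_set0. Qed.

Lemma psiUl A A' B : [disjoint A & A'] -> psi (A :|: A') B = psi A B * psi A' B.
Proof. by move=> d; rewrite /psi big_setU_disjoint. Qed.

Lemma psiUr A B B' : [disjoint B & B'] -> psi A (B :|: B') = psi A B * psi A B'.
Proof.
by move=> d; rewrite /psi -big_split; apply: eq_bigr => i _; rewrite /= big_setU_disjoint.
Qed.

Lemma psi1l i B : psi [set i] B = \prod_(j in B) ((x i - t * x j) / (x i - x j)).
Proof. by rewrite /psi big_set1. Qed.

Lemma psi1r i A : psi A [set i] = \prod_(j in A) ((x j - t * x i) / (x j - x i)).
Proof. by rewrite /psi; apply: eq_bigr => j _; rewrite big_set1. Qed.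

Lemma psiU1l i A B : i \notin A -> psi (i |: A) B = psi [set i] B * psi A B.
Proof. by move=> iA; rewrite psiUl // disjoints1. Qed.

Lemma psiU1r i A B : i \notin B -> psi A (i |: B) = psi A [set i] * psi A B.
Proof. by move=> iB; rewrite psiUr // disjoints1. Qed.

(** Every subset [A] of [V] occurs twice, with [i] in the complement and with [i] adjoined to
    [A]. *)
Lemma sum_psiU1 i V (w : {set T} -> K) : i \notin V ->
  \sum_(A : {set T} | A \subset i |: V) w A * psi A ((i |: V) :\: A) =
  \sum_(A : {set T} | A \subset V) psi A (V :\: A) *
    (w A * psi A [set i] + w (i |: A) * psi [set i] (V :\: A)).
Proof.
move=> iV; rewrite sum_subsetU1 //; apply: eq_bigr => A AV.
have iA := notin_subset iV AV.
rewrite setU1D // setU1DU1 // psiU1r ?notin_setD // psiU1l //.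
ring.
Qed.

Section Interpolation.
Variables (V : {set T}) (u v : {set T} -> {poly K}).

(** This is [interp] times [\prod_(j in V) (y - x j)], see [interpQ]. Writing (x_j - t y) / (x_j -
    y) as (t y - x_j) / (y - x_j) gives all terms the same denominator. *)
Let Q : {poly K} := \sum_(A : {set T} | A \subset V) psi A (V :\: A) *:
  (u A * (\prod_(j in V :\: A) (1 *: 'X - (t * x j)%:P) *
          \prod_(j in A) (1 *: 'X - (x j)%:P))
   + v A * (\prod_(j in A) (t *: 'X - (x j)%:P) *
          \prod_(j in V :\: A) (1 *: 'X - (x j)%:P))).

(* The value at a point [y] of the sum over the subsets of [V] with one variable
   [y] adjoined; [u] and [v] are the weights of the subsets with and without it. *)
Definition interp y := \sum_(A : {set T} | A \subset V) psi A (V :\: A) *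
  ((u A).[y] * \prod_(j in V :\: A) ((y - t * x j) / (y - x j))
   + (v A).[y] * \prod_(j in A) ((x j - t * y) / (x j - y))).

Lemma interpQ y : (forall j, j \in V -> y != x j) ->
  Q.[y] = interp y * \prod_(j in V) (y - x j).
Proof.
move=> yV; rewrite /Q /interp horner_sum mulr_suml; apply: eq_bigr => A AV.
rewrite hornerZ -mulrA; congr (_ * _).
rewrite hornerD !hornerM !horner_prod mulrDl -!mulrA.
rewrite (big_setD_subset _ _ AV) /=.
have sub_neq j : j \in V -> y - x j != 0 by move=> jV; rewrite subr_eq0 yV.
have AjV j : j \in A -> j \in V by move/(subsetP AV).
have DjV j : j \in V :\: A -> j \in V by rewrite inE => /andP[].
congr (_ * _ + _ * _).
  rewrite [RHS]mulrCA [RHS]mulrC; congr (_ * _).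
    by rewrite -big_split /=; apply: eq_bigr => j jV; rewrite !hornerE divfK ?sub_neq ?DjV.
  by apply: eq_bigr => j _; rewrite !hornerE.
rewrite mulrA; congr (_ * _); rewrite -?big_split; apply: eq_bigr => j jA /=.
  by rewrite !hornerE; field; rewrite subr_eq0 eq_sym yV // AjV.
by rewrite !hornerE.
Qed.

(** The two sides weigh the two subsets that differ by exchanging the adjoined point with [k]; their
    weights have to agree when the two variables coincide. *)
Hypothesis uv : forall k A, k \in V -> A \subset V :\ k ->
  (u A).[x k] = (v (k |: A)).[x k].

(* The residues at [y = x_k] of the terms indexed by [A] and [k |: A] cancel. *)
Lemma interp_root k : k \in V -> root Q (x k).
Proof.
move=> kV; apply/rootP; rewrite /Q horner_sum -{1}(setD1K kV).
set W := V :\ k; have kW : k \notin W by rewrite !inE eqxx.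
rewrite sum_subsetU1 // big1 // => A AW.
have kA := notin_subset kW AW.
rewrite -{1 2 3}(setD1K kV) -/W setU1D // -[in X in _ + X](setD1K kV) -/W setU1DU1 //.
set B := W :\: A; have kB : k \notin B by rewrite notin_setD.
rewrite psiU1r // psiU1l // !(hornerZ, hornerD, hornerM, horner_prod).
(* At [x k] only the [u] term of [A] and the [v] term of [k |: A] survive; the other two contain the
   factor [x k - x k]. *)
rewrite !(big_setU1 _ kB) /= !(big_setU1 _ kA) /= !hornerE ?mul1r subrr /= !(mul0r, mulr0) addr0.
rewrite add0r (uv kV AW) psi1r psi1l.
set w := (v _).[_].
have -> : \prod_(j in A) ((x j - t * x k) / (x j - x k)) =
   \prod_(j in A) (t * x k - x j) / \prod_(j in A) (x k - x j).
  rewrite -prodfV -big_split /=; apply: eq_bigr => j jA.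
  by rewrite -opprB mulNr -mulrN -invrN opprB.
have -> : \prod_(j in B) ((x k - t * x j) / (x k - x j)) =
   \prod_(j in B) (x k - t * x j) / \prod_(j in B) (x k - x j).
  by rewrite -prodfV -big_split.
have e1 : \prod_(j in A) (1 *: 'X - (x j)%:P).[x k] = \prod_(j in A) (x k - x j).
  by apply: eq_bigr => j _; rewrite !hornerE.
have e2 : \prod_(j in B) (1 *: 'X - (x j)%:P).[x k] = \prod_(j in B) (x k - x j).
  by apply: eq_bigr => j _; rewrite !hornerE.
have e3 : \prod_(j in B) (1 *: 'X - (t * x j)%:P).[x k] = \prod_(j in B) (x k - t * x j).
  by apply: eq_bigr => j _; rewrite !hornerE.
have e4 : \prod_(j in A) (t *: 'X - (x j)%:P).[x k] = \prod_(j in A) (t * x k - x j).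
  by apply: eq_bigr => j _; rewrite !hornerE.
rewrite e1 e2 e3 e4.
have nA : \prod_(j in A) (x k - x j) != 0.
  by apply/prodf_neq0 => j jA; apply: x_sub_neq0_in kA jA.
have nB : \prod_(j in B) (x k - x j) != 0.
  by apply/prodf_neq0 => j jB; apply: x_sub_neq0_in kB jB.
by field; rewrite nA nB.
Qed.

(** By [interp_root] the apparent poles of [interp] cancel, so [Q] is divisible by the product of
    the ['X - x j]. The power of [t] in the top coefficient comes from the factors [t *: 'X - x j]
    that accompany [v A]. *)
Lemma interp_poly d (cu cv : {set T} -> K) :
  (forall A, A \subset V -> top_coef (u A) d (cu A)) ->
  (forall A, A \subset V -> top_coef (v A) d (cv A)) ->
  exists2 P : {poly K},
    top_coef P d (\sum_(A : {set T} | A \subset V)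
                psi A (V :\: A) * (cu A + cv A * t ^+ #|A|)) &
    forall y, (forall j, j \in V -> y != x j) -> P.[y] = interp y.
Proof.
move=> hu hv.
have [P QP] : exists P, Q = P * \prod_(j in V) ('X - (x j)%:P).
  have := @uniq_roots_prod_XsubC _ Q [seq x j | j <- enum V].
  rewrite big_map big_enum /=; apply.
    by apply/allP => z /mapP[j]; rewrite mem_enum => jV ->; apply: interp_root.
  by rewrite uniq_rootsE map_inj_uniq ?enum_uniq.
set V_ := \prod_(j in V) ('X - (x j)%:P) in QP.
have V_top : top_coef V_ #|V| 1.
  have := top_coef_prod V (fun=> 1) x; rewrite big1_eq.
  by under eq_bigr do rewrite scale1r.
have V_mon : V_ \is monic by apply: monic_prod => j _; apply: monicXsubC.
have V_size : size V_ = #|V|.+1.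
  by rewrite /V_ -big_enum /= size_prod_XsubC -cardE.
have Qtop : top_coef Q (d + #|V|) (\sum_(A : {set T} | A \subset V)
                psi A (V :\: A) * (cu A + cv A * t ^+ #|A|)).
  apply: top_coef_sum => A AV; apply: top_coefZ.
  have cV : #|V| = (#|V :\: A| + #|A|)%N.
    by rewrite -(cardsID A V) addnC (setIidPr AV).
  apply: top_coefD.
    rewrite -[cu A]mulr1; apply: top_coefM; first exact: hu.
    have := top_coefM (top_coef_prod (V :\: A) (fun=> 1) (fun j => t * x j))
                  (top_coef_prod A (fun=> 1) x).
    by rewrite !big1_eq mulr1 -cV.
  apply: top_coefM; first exact: hv.
  have := top_coefM (top_coef_prod A (fun=> t) x) (top_coef_prod (V :\: A) (fun=> 1) x).
  by rewrite big1_eq mulr1 prodr_const addnC -cV.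
exists P; last first.
  move=> y yV; apply: (mulIf (_ : \prod_(j in V) (y - x j) != 0)).
    by apply/prodf_neq0 => j jV; rewrite subr_eq0 yV.
  rewrite -interpQ // QP hornerM horner_prod; congr (_ * _).
  by apply: eq_bigr => j _; rewrite !hornerE.
have sP : (size P <= d.+1)%N.
  have [->|P0] := eqVneq P 0; first by rewrite size_poly0.
  have [] := Qtop; rewrite QP size_Mmonic // V_size addnS /= => + _.
  by rewrite -addSn leq_add2r.
split=> //.
(* As [V_] is monic, [P] and [Q] have the same top coefficient. *)
have := top_coefM (conj sP erefl) V_top; rewrite mulr1 => -[_ <-].
by rewrite -QP; case: Qtop.
Qed.

End Interpolation.
End Psi.

(** * Subset sums of the products psi *)

(* The homogeneous Rogers-Szego polynomial [\sum_k al ^ (m - k) * be ^ k * binom(m, k)_t],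
   see [rs_tbinom]. *)
Fixpoint rs (R : pzRingType) (t : R) (m : nat) (al be : R) : R :=
  if m is m'.+1 then be * rs t m' al be + al * rs t m' al (t * be) else 1.

Section PsiSums.
Variables (K : fieldType) (T : finType) (t : K) (x : T -> K).
Hypothesis x_inj : injective x.
Implicit Types (i j k : T) (A B U V : {set T}).

Local Notation psi := (psi t x).

(** Entry point of the method: once the weights are polynomial in [x i], the other variables being
    fixed, the subset sum is the value at [x i] of an interpolated polynomial. *)
Lemma sum_psi_interp i V (w : {set T} -> K) (u v : {set T} -> {poly K}) :
  i \notin V ->
  (forall A, A \subset V -> (u A).[x i] = w (i |: A)) ->
  (forall A, A \subset V -> (v A).[x i] = w A) ->
  \sum_(A : {set T} | A \subset i |: V) w A * psi A ((i |: V) :\: A) =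
  interp t x V u v (x i).
Proof.
move=> iV uw vw; rewrite sum_psiU1 //; apply: eq_bigr => A AV.
by rewrite uw // vw // psi1l psi1r addrC.
Qed.

Lemma set_ind (P : {set T} -> Prop) :
  P set0 -> (forall i V, i \notin V -> P V -> P (i |: V)) -> forall V, P V.
Proof.
move=> P0 PS V; have [n] := ubnP #|V|; elim: n V => // n IH V.
have [->|[i iV]] := set_0Vmem V; first by [].
rewrite ltnS => Vn; rewrite -(setD1K iV); apply: PS; first by rewrite !inE eqxx.
by apply: IH; rewrite (cardsD1 i V) iV in Vn.
Qed.

Lemma sum_sub0 (M : nmodType) (F : {set T} -> M) :
  \sum_(A : {set T} | A \subset set0) F A = F set0.
Proof. by rewrite (big_pred1 set0) // => A; rewrite subset0. Qed.

Lemma neq_x_notin i V : i \notin V -> forall j, j \in V -> x i != x j.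
Proof. by move=> iV j jV; rewrite (inj_eq x_inj); apply: contraNneq iV => ->. Qed.

(** The weights do not involve [x i], so the sum over [i |: V] is a polynomial of degree 0 in [x i]
    and equals its top coefficient. There the factor [t ^+ #|A|] turns [be] into [t * be], which
    gives the recursion of [rs]. *)
Lemma sum_pow_psi U al be :
  \sum_(A : {set T} | A \subset U) al ^+ #|U :\: A| * be ^+ #|A| * psi A (U :\: A)
  = rs t #|U| al be.
Proof.
elim/set_ind: U be => [|i V iV IH] be.
  by rewrite sum_sub0 setD0 cards0 psi0l !mulr1.
pose w (c : K) A := (al ^+ #|V :\: A| * be ^+ #|A| * c)%:P.
rewrite (sum_psi_interp (u := w be) (v := w al)) //; last 2 first.
- move=> A AV; have iA := notin_subset iV AV.
  by rewrite hornerC setU1DU1 // cardsU1 iA exprS; ring.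
- move=> A AV; have iA := notin_subset iV AV.
  by rewrite hornerC setU1D // cardsU1 notin_setD // exprS; ring.
have [k A kV AW|||P [sP P0] PE] := @interp_poly K T t x x_inj V (w be) (w al) _
    (0) (fun A => al ^+ #|V :\: A| * be ^+ #|A| * be)
    (fun A => al ^+ #|V :\: A| * be ^+ #|A| * al).
- have kW : k \notin V :\ k by rewrite !inE eqxx.
  have kA := notin_subset kW AW.
  rewrite !hornerC -{1 2}(setD1K kV) setU1D // setU1DU1 // !cardsU1 notin_setD // kA.
  by rewrite !exprS; ring.
- by move=> A _; apply: top_coefC.
- by move=> A _; apply: top_coefC.
rewrite -PE; last exact: neq_x_notin.
rewrite (size1_polyC sP) hornerC P0 cardsU1 iV /= -!IH !mulr_sumr -big_split /=.
apply: eq_bigr => A _; rewrite exprMn; ring.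
Qed.

(** In the variable [x i] the sum is a polynomial of degree at most 1. Its top coefficient and its
    value at 0 both reduce to the sum over [V], whence the factor [1 + b * x i]. *)
Lemma sum_prod_psi U b : (forall i, x i != 0) ->
  \sum_(A : {set T} | A \subset U) b ^+ #|A| * (\prod_(i in A) x i) * psi A (U :\: A)
  = \prod_(i in U) (1 + b * x i).
Proof.
move=> x0; elim/set_ind: U => [|i V iV IH].
  by rewrite sum_sub0 cards0 psi0l !big_set0 !mulr1.
pose g A := b ^+ #|A| * \prod_(i in A) x i.
pose u A := (b * g A) *: 'X; pose v A := (g A)%:P.
have gU j A : j \notin A -> g (j |: A) = b * g A * x j.
  move=> jA; rewrite /g big_setU1 //= cardsU1 jA exprS; ring.
rewrite (sum_psi_interp (w := g) (u := u) (v := v)) //; last 2 first.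
- by move=> A AV; rewrite /u hornerZ hornerX gU // (notin_subset iV AV).
- by move=> A AV; rewrite /v hornerC.
have [k A kV AW|||P [sP P1] PE] := @interp_poly K T t x x_inj V u v _ 1 (fun A => b * g A) (fun A => 0).
- have kW : k \notin V :\ k by rewrite !inE eqxx.
  by rewrite /u /v hornerZ hornerX hornerC gU // (notin_subset kW AW).
- move=> A _; rewrite /u -[_ *: _]subr0 -[0]/(0%:P); exact: top_coef_linear.
- by move=> A _; apply: top_coefW; apply: top_coefC.
rewrite -PE; last exact: neq_x_notin.
(* At [y = 0] the [u] terms vanish and every quotient (x_j - t y) / (x_j - y) becomes 1; the point 0
   is admissible because no [x j] is 0. *)
have P00 : P`_0 = \prod_(i in V) (1 + b * x i).
  rewrite -horner_coef0 PE => [|j _]; last by rewrite eq_sym.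
  rewrite -IH; apply: eq_bigr => A _; rewrite /u /v hornerZ hornerX hornerC mulr0 mul0r add0r.
  rewrite big1 => [|j _]; last by rewrite mulr0 !subr0 divff.
  by rewrite mulr1 mulrC.
have {}P1 : P`_1 = b * \prod_(i in V) (1 + b * x i).
  rewrite P1 -IH mulr_sumr; apply: eq_bigr => A _; rewrite /g; ring.
rewrite big_setU1 //= (horner_coef_wide _ sP) !big_ord_recl big_ord0 /= P00.
rewrite -[P`_(bump _ _)]/(P`_1) P1 /=; ring.
Qed.

(** * The fixed point identity behind the case a = b = 0 *)

Section Littlewood.
Variable Phi : {set T} -> K.
Hypothesis x_neq0 : forall i, x i != 0.
Hypothesis x_gen : forall i j, x i * x j != 1.
Hypothesis two_neq0 : 2%:R != 0 :> K.
Hypothesis Phi0 : Phi set0 = 1.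
Hypothesis PhiU1 : forall i V, i \notin V -> Phi (i |: V) =
  Phi V / (1 - x i * x i) *
  \prod_(j in V) ((1 - t * (x i * x j)) / (1 - x i * x j)).

(** In the application [w U] is [Phi U] times the product of the squares of the variables in [U]. *)
Variable w : {set T} -> K.
Hypothesis w0 : w set0 = 1.
Hypothesis wU1 : forall i V, i \notin V -> w (i |: V) =
  w V * (x i * x i / (1 - x i * x i)) *
  \prod_(j in V) ((1 - t * (x i * x j)) / (1 - x i * x j)).

Let den_neq0 i j : 1 - x i * x j != 0.
Proof. by rewrite subr_eq0 eq_sym. Qed.

(* With [U = i |: V], both sides times [(1 - X ^ 2) \prod_(j in V) (1 - X x_j)] are
   polynomials in [X = x_i] of degree at most [#|V| + 1], since the coefficient of
   [X ^ (#|V| + 2)] cancels; they agree at [1], [-1] and the [x_j^-1] for [j] in [V]. *)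
Lemma sum_Littlewood U :
  \sum_(A : {set T} | A \subset U) w A * psi A (U :\: A) = Phi U.
Proof.
(* Strong induction: the values at 1 and -1 need the identity for [V], those at the inverses of the
   [x k] need it for [V :\ k]. *)
have [n] := ubnP #|U|; elim: n U => // n IH U.
have [->|[i iU]] := set_0Vmem U.
  by rewrite sum_sub0 psi0l w0 Phi0 mulr1.
rewrite ltnS (cardsD1 i U) iU add1n; rewrite -{2 3 4}(setD1K iU).
have iV : i \notin U :\ i by rewrite !inE eqxx.
move: (U :\ i) iV => V iV Vn {U iU}.
pose lin a : {poly K} := (- a) *: 'X - (-1)%:P.
have linE a y : (lin a).[y] = 1 - a * y.
  by rewrite /lin !(hornerD, hornerN, hornerM, hornerZ, hornerX, hornerC); ring.
pose X1 : {poly K} := 1 *: 'X - 1%:P; pose X2 : {poly K} := 1 *: 'X - (-1)%:P.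
have X12E y : (X1 * X2).[y] = - (1 - y * y) by rewrite /X1 /X2 !(hornerD, hornerN, hornerM, hornerZ, hornerX, hornerC); ring.
(* [u A] and [v A] are [w (i |: A)] and [w A], multiplied by (1 - X^2) \prod_(j in V) (1 - x_j X)
   and read as polynomials in X = x_i. Below, [R] is the right-hand side treated in the same way. *)
pose u A := w A *: ((1 *: 'X - 0%:P) * (1 *: 'X - 0%:P) *
   (\prod_(j in A) lin (t * x j) * \prod_(j in V :\: A) lin (x j))).
pose v A := (- w A) *: (X1 * X2 * \prod_(j in V) lin (x j)).
have uE A y : (u A).[y] = w A * (y * y) *
  (\prod_(j in A) (1 - t * x j * y) * \prod_(j in V :\: A) (1 - x j * y)).
  rewrite /u hornerZ !hornerM !horner_prod.
  under eq_bigr do rewrite linE.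
  under [X in _ * (_ * (_ * X))]eq_bigr do rewrite linE.
  by rewrite !(hornerD, hornerN, hornerM, hornerZ, hornerX, hornerC); ring.
have vE A y : (v A).[y] = w A * (1 - y * y) * \prod_(j in V) (1 - x j * y).
  rewrite /v hornerZ hornerM X12E horner_prod; under eq_bigr do rewrite linE.
  by ring.
pose R := Phi V *: \prod_(j in V) lin (t * x j).
have RE y : R.[y] = Phi V * \prod_(j in V) (1 - t * x j * y).
  by rewrite /R hornerZ horner_prod; under eq_bigr do rewrite linE.
have [k A kV AW|||P Ptop PE] := @interp_poly K T t x x_inj V (u) (v) _
    (#|V|.+2) (fun A => w A * (t ^+ #|A| * \prod_(j in V) (- x j)))
    (fun A => - w A * \prod_(j in V) (- x j)).
- have kW : k \notin V :\ k by rewrite !inE eqxx.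
  have kA := notin_subset kW AW.
  rewrite uE vE wU1 //.
  have AV : A \subset V by apply: subset_trans AW _; apply: subD1set.
  rewrite [\prod_(j in V) _](big_setD_subset _ _ AV) /=.
  have eA : \prod_(j in A) ((1 - t * (x k * x j)) / (1 - x k * x j)) =
     \prod_(j in A) (1 - t * x j * x k) / \prod_(j in A) (1 - x j * x k).
    rewrite -prodfV -big_split /=; apply: eq_bigr => j _.
    by rewrite [x k * _]mulrC mulrA.
  have nA : \prod_(j in A) (1 - x j * x k) != 0 by apply/prodf_neq0.
  rewrite eA; field; rewrite nA; exact: den_neq0.
- move=> A AV.
  have -> : \prod_(j in V) - x j =
      (\prod_(j in A) - x j) * \prod_(j in V :\: A) - x j.
    by rewrite (big_setD_subset _ _ AV).
  apply: top_coefZ; rewrite -[#|V|.+2]add2n -[X in top_coef _ _ X]mul1r; apply: top_coefM.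
    rewrite -[1 in X in top_coef _ _ X](mulr1 1); exact: top_coefM (top_coef_linear _ _) (top_coef_linear _ _).
  have cV : #|V| = (#|A| + #|V :\: A|)%N by rewrite -(cardsID A V) (setIidPr AV).
  rewrite cV mulrA; apply: top_coefM; last exact: top_coef_prod.
  have -> : t ^+ #|A| * \prod_(j in A) - x j = \prod_(j in A) - (t * x j).
    by rewrite -prodr_const -big_split /=; apply: eq_bigr => j _; rewrite mulrN.
  exact: top_coef_prod.
- move=> A AV; apply: top_coefZ; rewrite -[#|V|.+2]add2n -[X in top_coef _ _ X]mul1r; apply: top_coefM.
    rewrite -[1 in X in top_coef _ _ X](mulr1 1); exact: top_coefM (top_coef_linear _ _) (top_coef_linear _ _).
  exact: top_coef_prod.
(* For each [A] the coefficients [cu A] and [cv A * t ^+ #|A|] are opposite, which lowers the degree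
   by one. *)
have {}Ptop : (size P <= #|V|.+2)%N.
  apply: top_coef0; rewrite big1 in Ptop => // A _; ring.
have Rsize : (size R <= #|V|.+1)%N.
  have [] := top_coefZ (Phi V) (top_coef_prod V (fun j => - (t * x j)) (fun=> -1)).
  by [].
(* For e = 1/e the [v] terms vanish and (e - t x_j) / (e - x_j) = (1 - t x_j e) / (1 - x_j e), so
   each [u] term becomes [w A * psi A (V :\: A)] times a factor independent of [A]. *)
have e_root e : e * e = 1 -> P.[e] = R.[e].
  move=> e1; have e0 : e != 0.
    by apply: contra_eqN e1 => /eqP->; rewrite mul0r eq_sym oner_eq0.
  have eV j : j \in V -> e != x j.
    by move=> _; apply: contra_eqN e1 => /eqP ->.
  rewrite PE // RE -(IH V) // mulr_suml; apply: eq_bigr => A AV.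
  rewrite uE vE e1 subrr mulr0 !mul0r addr0 mulr1 (big_setD_subset _ _ AV) /=.
  rewrite -!mulrA [LHS]mulrCA; congr (_ * (_ * (_ * _))).
  rewrite -big_split /=; apply: eq_bigr => j; rewrite inE => /andP[_ jV] /=.
  have ej : e - x j != 0 by rewrite subr_eq0 eV.
  have -> : e - t * x j = e * (1 - t * x j * e) by rewrite mulrBr mulr1 mulrCA e1 mulr1.
  have -> : e - x j = e * (1 - x j * e) by rewrite mulrBr mulr1 mulrCA e1 mulr1.
  have ej' : 1 - x j * e != 0.
    apply: contraNneq ej => ej; rewrite -[e - _]mul1r -e1 -mulrA mulrBr e1.
    by rewrite [e * x j]mulrC ej mulr0.
  by field; rewrite e0 ej'.
(* At 1/x_k the factor [1 - x k * y] kills all [v] terms and the [u] terms of the subsets without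
   [k]. The terms of the sets [k |: A] are matched with the sum for [W = V :\ k]. *)
have inv_root k : k \in V -> P.[(x k)^-1] = R.[(x k)^-1].
  move=> kV; set y := (x k)^-1.
  have xy : x k * y = 1 by rewrite divff.
  have yx : y * x k = 1 by rewrite mulVf.
  have yV j : j \in V -> y != x j.
    by move=> _; apply: contraNneq (x_gen k j) => <-; rewrite xy.
  have kW : k \notin V :\ k by rewrite !inE eqxx.
  have VE := setD1K kV; rewrite (cardsD1 k V) kV add1n in Vn.
  rewrite PE // RE /interp -VE; move: (V :\ k) kW VE Vn => W kW VE Wn.
  have v0 A : (v A).[y] = 0.
    by rewrite vE -VE big_setU1 //= xy subrr mul0r mulr0.
  have u0 A : A \subset W -> (u A).[y] = 0.
    move=> AW; rewrite uE -VE setU1D // [X in _ * (_ * X)]big_setU1 ?notin_setD //=.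
    by rewrite xy subrr mul0r !mulr0.
  rewrite sum_subsetU1 // PhiU1 // big_setU1 //= -(IH W) ?(ltnW Wn) //.
  rewrite !mulr_suml; apply: eq_bigr => A AW.
  have kA := notin_subset kW AW.
  rewrite u0 // !v0 !mul0r !addr0 mulr0 add0r setU1DU1 // psiU1l // psi1l.
  rewrite uE -VE wU1 // setU1DU1 // (big_setU1 _ kA) /= !(big_setD_subset _ _ AW) /=.
  set B := W :\: A.
  have hB : \prod_(j in B) ((1 - t * (x k * x j)) / (1 - x k * x j)) *
     \prod_(j in B) (1 - t * x j * y) =
     \prod_(j in B) ((x k - t * x j) / (x k - x j)) * \prod_(j in B) (1 - x j * y) *
     \prod_(j in B) ((y - t * x j) / (y - x j)).
    rewrite -!big_split; apply: eq_bigr => j jB /=.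
    have kB := notin_setD A kW.
    have d1 := x_sub_neq0_in x_inj kB jB.
    have d2 : y - x j != 0.
      rewrite subr_eq0; apply: contraNneq (x_gen k j) => yj.
      by rewrite -yj xy.
    by rewrite /y in d2 *; field; rewrite d1 x_neq0 mulNr den_neq0.
  rewrite -/B -[t * x k * y]mulrA xy mulr1.
  move: hB (den_neq0 k k) xy.
  set p1 := \prod_(j in B) ((1 - t * (x k * x j)) / (1 - x k * x j)).
  set p2 := \prod_(j in B) (1 - t * x j * y).
  set p3 := \prod_(j in B) ((x k - t * x j) / (x k - x j)).
  set p4 := \prod_(j in B) (1 - x j * y).
  set p5 := \prod_(j in B) ((y - t * x j) / (y - x j)).
  set p6 := \prod_(j in A) _; set p7 := \prod_(j in A) _.
  move=> hB d xy; transitivity (p3 * p4 * p5 *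
     (psi A B * (w A / (1 - x k * x k)) * p6 * p7 * (1 - t) * (x k * y) ^+ 2)).
    by ring.
  by rewrite -hB xy; ring.
have PR : P = R.
  apply/eqP; rewrite -subr_eq0; apply/negPn/negP => PR0.
  (* These are [#|V| + 2] distinct roots, more than the degree of [P - R] allows: 1 and -1 differ as
     2 is nonzero, and no [x j] squares to 1. *)
  pose rt := 1 :: (-1) :: [seq (x j)^-1 | j <- enum V].
  have rtP : all (root (P - R)) rt.
    rewrite /= /root !(hornerD, hornerN) !e_root ?subrr ?eqxx //= ?mulrNN ?mulr1 //.
    apply/allP => z /mapP[j]; rewrite mem_enum => jV ->.
    by rewrite /root !(hornerD, hornerN) inv_root // subrr.
  have inv_neq e j : e * e = 1 -> (x j)^-1 != e.
    move=> e1; apply: contraNneq (x_gen j j) => je.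
    by rewrite -[x j]invrK je -invfM e1 invr1.
  have rtU : uniq rt.
    rewrite /= inE negb_or map_inj_uniq ?enum_uniq ?andbT; last first.
      by move=> j k /invr_inj /x_inj.
    apply/andP; split.
      apply/andP; split; first by rewrite -subr_eq0 opprK -[1 + 1]/(2%:R).
      by apply/mapP => -[j _ /esym/eqP]; apply/negP/inv_neq; rewrite mulr1.
    by apply/mapP => -[j _ /esym/eqP]; apply/negP/inv_neq; rewrite mulrNN mulr1.
  have := max_poly_roots PR0 rtP rtU; rewrite /= size_map -cardE ltnNge.
  rewrite (leq_trans (size_polyD _ _)) // geq_max Ptop size_polyN.
  exact: leq_trans Rsize _.
have iV' := neq_x_notin iV.
pose q := \prod_(j in V) (1 - x j * x i).
have q0 : q * (1 - x i * x i) != 0.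
  by rewrite mulf_neq0 ?den_neq0 //; apply/prodf_neq0 => j _.
apply: (mulIf q0); transitivity P.[x i].
  rewrite PE // sum_psiU1 // mulr_suml; apply: eq_bigr => A AV.
  rewrite uE vE wU1 ?(notin_subset iV) // psi1r psi1l -!mulrA; congr (_ * _).
  rewrite /q (big_setD_subset _ _ AV) /=.
  have -> : \prod_(j in A) ((1 - t * (x i * x j)) / (1 - x i * x j)) =
     \prod_(j in A) (1 - t * x j * x i) / \prod_(j in A) (1 - x j * x i).
    rewrite -prodfV -big_split /=; apply: eq_bigr => j _.
    by rewrite [x i * _]mulrC mulrA.
  have nA : \prod_(j in A) (1 - x j * x i) != 0 by apply/prodf_neq0.
  by field; rewrite nA den_neq0.
rewrite PR RE PhiU1 // /q.
have -> : \prod_(j in V) ((1 - t * (x i * x j)) / (1 - x i * x j)) =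
   \prod_(j in V) (1 - t * x j * x i) / \prod_(j in V) (1 - x j * x i).
  rewrite -prodfV -big_split /=; apply: eq_bigr => j _.
  by rewrite [x i * _]mulrC mulrA.
have nV : \prod_(j in V) (1 - x j * x i) != 0 by apply/prodf_neq0.
by field; rewrite nV den_neq0.
Qed.
End Littlewood.
End PsiSums.

(** * Level operators *)

(** A chain J <= I <= U is given by [J] and the difference [S] of [I] and [J]. *)
Lemma sum_subset_chain (T : finType) (M : nmodType) (F : {set T} -> {set T} -> M)
    (U : {set T}) :
  \sum_(I : {set T} | I \subset U) \sum_(J : {set T} | J \subset I) F I J =
  \sum_(J : {set T} | J \subset U) \sum_(S : {set T} | S \subset U :\: J) F (J :|: S) J.
Proof.
rewrite (exchange_big_dep (fun J : {set T} => J \subset U)) /=; last first.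
  by move=> I J IU JI; apply: subset_trans JI IU.
apply: eq_bigr => J JU.
rewrite (reindex_onto (fun S => J :|: S) (fun I => I :\: J)) /=; last first.
  by move=> I /andP[_ /setIidPr JI]; rewrite -{1}JI setID.
apply: eq_bigl => S; rewrite subsetUl andbT subUset JU /= setDUl setDv set0U.
rewrite subsetD; congr (_ && _).
by apply/eqP/idP => [/setDidPl // | /setDidPl].
Qed.

Section Operators.
Variables (K : fieldType) (T : finType) (t : K) (x : T -> K).
Hypothesis x_inj : injective x.
Hypothesis x_neq0 : forall i, x i != 0.
Implicit Types (I J S U V : {set T}) (phi : {set T} -> K) (om : nat -> K).

Local Notation psi := (psi t x).

(* [U] stands for the set of indices not yet assigned a value: [Lop om] chooses the
   level [U :\: I] of the smallest value, with weight [om #|U :\: I|], and [Xop]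
   raises the values on the remaining set by one. *)
Definition Lop om phi U :=
  \sum_(I : {set T} | I \subset U) om #|U :\: I| * psi I (U :\: I) * phi I.
Definition Xop phi U := (\prod_(i in U) x i) * phi U.
Definition Yop b phi U := (\prod_(i in U) (1 + b * x i)) * phi U.
Definition pow_weight (c : K) (m : nat) := c ^+ m.

Lemma eq_Lop om om' phi phi' U :
  om =1 om' -> phi =1 phi' -> Lop om phi U = Lop om' phi' U.
Proof. by move=> eo ep; apply: eq_bigr => I _; rewrite eo ep. Qed.

Lemma eq_Xop phi phi' U : phi =1 phi' -> Xop phi U = Xop phi' U.
Proof. by move=> ep; rewrite /Xop ep. Qed.

Lemma disjointsD I S U : S \subset U :\: I -> [disjoint I & S].
Proof. by rewrite subsetD disjoint_sym => /andP[]. Qed.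

Lemma setDDU I S U : S \subset U :\: I -> U :\: I = S :|: (U :\: (I :|: S)).
Proof.
move=> /setIidPr SU; rewrite -setDDl -{1}(setID (U :\: I) S).
by rewrite SU.
Qed.

Lemma psi_split I S U : S \subset U :\: I ->
  psi I (U :\: I) = psi I S * psi I (U :\: (I :|: S)).
Proof.
move=> SU; rewrite {1}(setDDU SU) psiUr //.
rewrite -setDDl disjoint_sym.
by have := subxx (U :\: I :\: S); rewrite subsetD => /andP[].
Qed.

Lemma card_setDU I S U : S \subset U :\: I ->
  #|U :\: I| = (#|S| + #|U :\: (I :|: S)|)%N.
Proof.
move=> SU; rewrite -setDDl -(cardsID S (U :\: I)); congr (_ + _)%N.
by rewrite (setIidPr SU).
Qed.

Lemma setUDK I S U : S \subset U :\: I -> (I :|: S) :\: I = S.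
Proof.
by move=> /disjointsD d; rewrite setDUl setDv set0U; apply/setDidPl; rewrite disjoint_sym.
Qed.

(** For a fixed final set [J], the factor [psi J (U :\: J)] does not depend on the intermediate set
    [J :|: S]; what remains is the sum over [S] evaluated by [sum_pow_psi]. *)
Lemma Lop_comp al be phi U :
  Lop (pow_weight al) (Lop (pow_weight be) phi) U = Lop (fun m => rs t m al be) phi U.
Proof.
rewrite /Lop; under eq_bigr do rewrite mulr_sumr.
rewrite sum_subset_chain; apply: eq_bigr => J JU.
rewrite -(sum_pow_psi t x_inj) !mulr_suml; apply: eq_bigr => S SU.
rewrite (setUDK SU) psiUl ?(disjointsD SU) // setDDl (psi_split SU) /pow_weight; ring.
Qed.

(* The Pieri rule for the elementary symmetric functions: expanding the factors
   [1 + b x_i] of a level moves a subset [S] of it one level up. *)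
Lemma Yop_Lop b c phi U :
  Yop b (Lop (pow_weight c) (Xop phi)) U = Lop (pow_weight c) (Xop (Lop (pow_weight (b * c)) (Yop b phi))) U.
Proof.
rewrite /Yop /Lop /Xop mulr_sumr.
under [RHS]eq_bigr do rewrite mulr_sumr mulr_sumr.
rewrite sum_subset_chain; apply: eq_bigr => I IU.
rewrite (big_setD_subset _ _ IU) /= -(sum_prod_psi t x_inj (U :\: I)) //.
rewrite mulr_sumr mulr_suml; apply: eq_bigr => S SU.
rewrite (setUDK SU) psiUl ?(disjointsD SU) // setDDl (psi_split SU) /pow_weight (card_setDU SU).
by rewrite big_setU_disjoint ?(disjointsD SU) //= exprMn exprD; ring.
Qed.

Lemma Xop_Yop b phi U : Xop (Yop b phi) U = Yop b (Xop phi) U.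
Proof. by rewrite /Xop /Yop mulrCA. Qed.

(** The terminal condition that no index is left without a value. With it, [littlewood_trunc k]
    collects the functions whose values are even and below 2k. *)
Definition delta0 U : K := (U == set0)%:R.

Fixpoint littlewood_trunc k : {set T} -> K :=
  if k is k'.+1 then Lop (pow_weight 1) (Xop (Xop (littlewood_trunc k'))) else delta0.

(** Here [om l] is the weight of level [l], and [phi] acts on the indices left after the levels 0,
    ..., N - 1. *)
Fixpoint chain (om : nat -> nat -> K) N phi : {set T} -> K :=
  if N is N'.+1 then Lop (om 0) (Xop (chain (fun l => om l.+1) N' phi)) else phi.

Lemma eq_chain (om om' : nat -> nat -> K) N phi U :
  (forall l m, om l m = om' l m) -> chain om N phi U = chain om' N phi U.
Proof.
elim: N om om' U => // N IH om om' U e /=; apply: eq_Lop => // J.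
by apply: eq_Xop => I; apply: IH => l m.
Qed.

Definition level_weight (a b : K) (l : nat) : nat -> K :=
  if odd l then fun m => rs t m a b else fun m => rs t m (a * b) 1.

(** [Yop b] crosses one [Lop] and commutes with the second [Xop], leaving weights b on the odd
    level; [Yop a] then crosses both levels, leaving a on the odd one and ab in front of the next
    period. *)
Lemma Yop_littlewoodS a b k U :
  Yop a (Yop b (littlewood_trunc k.+1)) U =
  Lop (pow_weight 1) (Xop (Lop (fun m => rs t m a b) (Xop (Lop (pow_weight (a * b))
    (Yop a (Yop b (littlewood_trunc k))))))) U.
Proof.
transitivity (Yop a (Lop (pow_weight 1) (Xop (Lop (pow_weight b) (Xop (Yop b (littlewood_trunc k)))))) U).
  congr (_ * _); rewrite /= Yop_Lop; apply: eq_Lop => // J.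
  apply: eq_Xop => {}J; apply: eq_Lop => [m|{}J]; first by rewrite mulr1.
  by rewrite -Xop_Yop.
rewrite Yop_Lop; apply: eq_Lop => // J; apply: eq_Xop => {}J.
rewrite -Lop_comp; apply: eq_Lop => [m|{}J]; first by rewrite mulr1.
by rewrite Yop_Lop.
Qed.

(** The leftover [Lop (pow_weight (a * b))] merges with the weight 1 of the next even level into
    [rs t m (a * b) 1]. After the last period it acts on [delta0]. *)
Lemma chain_littlewood a b k U :
  Lop (pow_weight (a * b)) (Yop a (Yop b (littlewood_trunc k))) U =
  chain (level_weight a b) (2 * k) (Lop (pow_weight (a * b)) delta0) U.
Proof.
elim: k U => [|k IH] U.
  apply: eq_Lop => // I; rewrite /Yop /= /delta0; case: eqVneq => [->|]; last by rewrite !mulr0.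
  by rewrite !big_set0 !mulr1.
rewrite mulnS !addSn add0n /=.
rewrite (eq_Lop _ (fun=> erefl) (Yop_littlewoodS a b k)) Lop_comp; apply: eq_Lop => // I.
apply: eq_Xop => {}I; apply: eq_Lop => // J; apply: eq_Xop => {}J.
by rewrite IH; apply: eq_chain => l m; rewrite /level_weight /= negbK.
Qed.

(** The indices of level 0 are the zeros of f, which are not parts; hence weight 1 there, in
    contrast with the other even levels. *)
Definition part_weight (a b : K) (l : nat) : nat -> K :=
  if l is 0 then pow_weight 1 else level_weight a b l.

Lemma Yop_littlewood a b k U :
  Yop a (Yop b (littlewood_trunc k.+1)) U =
  chain (part_weight a b) (2 * k.+1) (Lop (pow_weight (a * b)) delta0) U.
Proof.
rewrite mulnS !addSn add0n /= Yop_littlewoodS; apply: eq_Lop => // I.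
apply: eq_Xop => {}I; apply: eq_Lop => // J; apply: eq_Xop => {}J.
by rewrite chain_littlewood; apply: eq_chain => l m; rewrite /level_weight /= negbK.
Qed.

End Operators.

(** * Chains of level operators as sums over functions *)

Section Functions.
Variables (K : fieldType) (T : finType) (t : K) (x : T -> K).
Implicit Types (I J S U V : {set T}) (phi : {set T} -> K).

Definition hl_on U (f : T -> nat) : K :=
  (\prod_(i in U) x i ^+ f i) *
  \prod_(i in U) \prod_(j in U | (f j < f i)%N) ((x i - t * x j) / (x i - x j)).

Definition weight_on (om : nat -> nat -> K) N U (f : T -> nat) : K :=
  \prod_(l < N) om l #|[set i in U | f i == l :> nat]|.

Local Notation natf f := (fun i => nat_of_ord (f i)).

Definition ext0 N I (g : T -> 'I_N) : {ffun T -> 'I_N.+1} :=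
  [ffun i => if i \in I then lift ord0 (g i) else ord0].

Lemma ext0_in N I (g : T -> 'I_N) i : i \in I -> ext0 I g i = (g i).+1 :> nat.
Proof. by rewrite ffunE => ->; rewrite lift0. Qed.

Lemma ext0_out N I (g : T -> 'I_N) i : i \notin I -> ext0 I g i = 0%N :> nat.
Proof. by rewrite ffunE => /negPf->. Qed.

(** Pairs of an index in [I] and one of value 0 give [psi I (U :\: I)]; within [I] the common shift
    of the values by one changes no comparison. *)
Lemma hl_on_ext0 N I U (g : T -> 'I_N) : I \subset U ->
  hl_on U (natf (ext0 I g)) = psi t x I (U :\: I) * (\prod_(i in I) x i) * hl_on I (natf g).
Proof.
move=> IU; rewrite /hl_on !(big_setD_subset _ _ IU) /=.
rewrite [X in (_ * X) * _ = _]big1 => [|i]; last first.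
  by rewrite inE => /andP[iI _]; rewrite ext0_out.
rewrite [X in _ * (_ * X) = _]big1 => [|i]; last first.
  rewrite inE => /andP[iI _]; apply: big1 => j.
  by rewrite (ext0_out g iI) ltn0 andbF.
rewrite !mulr1.
have -> : \prod_(i in I) x i ^+ ext0 I g i =
    (\prod_(i in I) x i) * \prod_(i in I) x i ^+ g i.
  by rewrite -big_split; apply: eq_bigr => i iI; rewrite /= ext0_in // exprS.
have -> : \prod_(i in I) \prod_(j in U | (ext0 I g j < ext0 I g i)%N)
     ((x i - t * x j) / (x i - x j)) =
   psi t x I (U :\: I) *
   \prod_(i in I) \prod_(j in I | (g j < g i)%N) ((x i - t * x j) / (x i - x j)).
  rewrite /psi -big_split; apply: eq_bigr => i iI /=.
  rewrite big_mkcondr /= (big_setD_subset _ _ IU) /= mulrC; congr (_ * _).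
    apply: eq_bigr => j; rewrite inE => /andP[jI _].
    by rewrite (ext0_in g iI) (ext0_out g jI).
  rewrite [RHS]big_mkcondr; apply: eq_bigr => j jI.
  by rewrite !ext0_in // ltnS.
ring.
Qed.

Lemma weight_on_ext0 om N I U (g : T -> 'I_N) : I \subset U ->
  weight_on om N.+1 U (natf (ext0 I g)) =
  om 0 #|U :\: I| * weight_on (fun l => om l.+1) N I (natf g).
Proof.
move=> IU; rewrite /weight_on big_ord_recl; congr (om _ #|pred_of_set _| * _).
  apply/setP => i; rewrite !inE; case: (boolP (i \in I)) => iI.
    by rewrite ext0_in // andbF.
  by rewrite ext0_out // andbT.
apply: eq_bigr => l _; congr (om _ #|pred_of_set _|).
apply/setP => i; rewrite !inE; case: (boolP (i \in I)) => iI.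
  by rewrite ext0_in // lift0 eqSS (subsetP IU).
by rewrite ext0_out // andbF.
Qed.

(** Functions on [U] are encoded as functions on [T] that vanish off [U], so that each is counted
    once. *)
Definition supp_in N U (f : {ffun T -> 'I_N.+1}) :=
  [forall i, (i \notin U) ==> (f i == ord0)].

Lemma sum_supp_in N U (F : {ffun T -> 'I_N.+2} -> K) :
  \sum_(f : {ffun T -> 'I_N.+2} | supp_in U f) F f =
  \sum_(I : {set T} | I \subset U)
    \sum_(g : {ffun T -> 'I_N.+1} | supp_in I g) F (ext0 I g).
Proof.
pose supp (f : {ffun T -> 'I_N.+2}) := [set i | f i != ord0].
rewrite (partition_big supp (fun I => I \subset U)) /=; last first.
  move=> f /forallP fU; apply/subsetP => i; rewrite inE; apply: contraR => iU.
  by have := fU i; rewrite iU.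
apply: eq_bigr => I IU.
rewrite (reindex_onto (fun g : {ffun T -> 'I_N.+1} => ext0 I g)
  (fun f => [ffun i => inord (f i).-1])) /=; last first.
  move=> f /andP[_ /eqP <-]; apply/ffunP => i; apply: val_inj => /=.
  case: (boolP (i \in supp f)) => iI.
    rewrite ext0_in // ffunE; move: iI; rewrite inE -val_eqE /= => fi.
    by rewrite inordK ?prednK ?lt0n // -ltnS.
  by rewrite ext0_out //; move: iI; rewrite inE negbK => /eqP->.
apply: eq_bigl => g; apply/idP/forallP => [/andP[_ /eqP <-] i|gI].
  by apply/implyP => iI; rewrite ffunE ext0_out //; apply/eqP/val_inj; rewrite /= inordK.
rewrite -andbA; apply/and3P; split.
- apply/forallP => i; apply/implyP => iU.
  by rewrite -val_eqE /= ext0_out //; apply: contra iU; apply: (subsetP IU).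
- apply/eqP/setP => i; rewrite inE -val_eqE /=; case: (boolP (i \in I)) => iI.
    by rewrite ext0_in.
  by rewrite ext0_out.
apply/eqP/ffunP => i; rewrite ffunE; apply: val_inj; case: (boolP (i \in I)) => iI.
  by rewrite ext0_in //= inordK.
rewrite ext0_out //= inordK //.
by have := gI i; rewrite iI => /eqP->.
Qed.

(** Induction on [N] by splitting off the level of value 0. The final [Lop (om N) delta0] gives the
    value [N] to all remaining indices, so that the values run over 0, ..., N. *)
Lemma chain_sum om N U :
  chain t x om N (Lop t x (om N) (@delta0 K T)) U =
  \sum_(f : {ffun T -> 'I_N.+1} | supp_in U f) weight_on om N.+1 U (natf f) * hl_on U (natf f).
Proof.
elim: N om U => [|N IH] om U.
  have f0 (f : {ffun T -> 'I_1}) i : f i = 0 :> nat by case: (f i) => -[].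
  rewrite (big_pred1 [ffun=> ord0]); last first.
    move=> f; apply/forallP/eqP => [_|-> i]; last by rewrite ffunE eqxx implybT.
    by apply/ffunP => i; apply: val_inj; rewrite /= !f0.
  rewrite /= /Lop (bigD1 set0) ?sub0set //= big1 ?addr0; last first.
    by move=> I /andP[_ /negPf I0]; rewrite /delta0 I0 mulr0.
  rewrite setD0 psi0l /delta0 eqxx !mulr1 /weight_on big_ord1.
  have -> : [set i in U | [ffun=> ord0 : 'I_1] i == 0 :> nat] = U.
    by apply/setP => i; rewrite !inE f0 eqxx andbT.
  rewrite /hl_on !big1 ?mulr1 // => i _; last by rewrite f0.
  by apply: big1 => j; rewrite !f0 ltnn andbF.
rewrite sum_supp_in /=; apply: eq_bigr => I IU.
rewrite /Xop (IH (fun l => om l.+1)) !mulr_sumr; apply: eq_bigr => g _.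
by rewrite weight_on_ext0 // hl_on_ext0 //; ring.
Qed.

End Functions.

(** * Hall-Littlewood functions are polynomials *)

Section Renaming.
Variables (R : idomainType) (n : nat).
Implicit Types (p q : {mpoly R[n]}) (s : 'I_n -> 'I_n) (i j k l : 'I_n).

Definition rename s p : {mpoly R[n]} := mmap (@mpolyC n R) (fun i => 'X_(s i)) p.

HB.instance Definition _ s := GRing.RMorphism.copy (rename s)
  (mmap (@mpolyC n R) (fun i => 'X_(s i))).

Lemma renameC s c : rename s c%:MP = c%:MP.
Proof. exact: mmapC. Qed.

Lemma renameX s i : rename s 'X_i = 'X_(s i).
Proof. by rewrite /rename mmapX mmap1U. Qed.

Lemma mpoly_gen_ind (P : {mpoly R[n]} -> Prop) :
  (forall c, P c%:MP) -> (forall i, P 'X_i) ->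
  (forall p q, P p -> P q -> P (p + q)) -> (forall p q, P p -> P q -> P (p * q)) ->
  forall p, P p.
Proof.
move=> PC PX PD PM p; rewrite [p]mpolyE.
have P0 : P 0 by rewrite -(mpolyC0 n R).
have P1 : P 1 by rewrite -(mpolyC1 n R).
apply: (big_ind P) => [|u v|m _]; [exact: P0 | exact: PD | ].
rewrite -mul_mpolyC; apply: (PM _ _ (PC _)).
rewrite mpolyXE_id; apply: (big_ind P) => [|u v|i _]; [exact: P1 | exact: PM | ].
by elim: (m i) => [|k IH]; [exact: P1 | rewrite exprS; apply: (PM _ _ (PX i) IH)].
Qed.

Lemma rename_comp s s' s'' p : s \o s' =1 s'' -> rename s (rename s' p) = rename s'' p.
Proof.
move=> e; elim/mpoly_gen_ind: p => [c|i|p q IHp IHq|p q IHp IHq].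
- by rewrite !renameC.
- by rewrite !renameX -e.
- by rewrite !rmorphD /= IHp IHq.
- by rewrite !rmorphM /= IHp IHq.
Qed.

Lemma mpolyX_sub_neq0 i j : i != j -> 'X_i - 'X_j != 0 :> {mpoly R[n]}.
Proof.
move=> ij; apply/eqP => /(congr1 (mcoeff U_(i)%MM)) /eqP.
by rewrite mcoeffB !mcoeffXU eqxx [j == i]eq_sym (negPf ij) subr0 mcoeff0 oner_eq0.
Qed.

Definition collapse k l i := if i == k then l else i.

(** Modulo ['X_l - 'X_k] the substitution is the identity, as is checked on constants and
    variables. *)
Lemma collapse_dvd k l p : rename (collapse k l) p = 0 ->
  exists q, p = ('X_l - 'X_k) * q.
Proof.
suff [q e] : exists q, rename (collapse k l) p - p = ('X_l - 'X_k) * q.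
  by move=> p0; exists (- q); rewrite mulrN -e p0 sub0r opprK.
elim/mpoly_gen_ind: p => [c|i|p1 p2 [q1 e1] [q2 e2]|p1 p2 [q1 e1] [q2 e2]].
- by exists 0; rewrite renameC subrr mulr0.
- rewrite renameX /collapse; case: eqVneq => [->|_]; first by exists 1; rewrite mulr1.
  by exists 0; rewrite subrr mulr0.
- by exists (q1 + q2); rewrite rmorphD /= mulrDr -e1 -e2; ring.
exists (q1 * rename (collapse k l) p2 + p1 * q2); rewrite rmorphM /=.
by rewrite mulrDr mulrA mulrCA -e1 -e2; ring.
Qed.

Lemma collapse_prod_dvd p (r : seq ('I_n * 'I_n)) :
  uniq r -> all (fun ij : 'I_n * 'I_n => (ij.1 < ij.2)%N) r ->
  (forall k l, (k < l)%N -> rename (collapse k l) p = 0) ->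
  exists q, p = (\prod_(ij <- r) ('X_ij.2 - 'X_ij.1)) * q.
Proof.
move=> + + p0; elim: r => [|[k l] r IH] /=; first by exists p; rewrite big_nil mul1r.
case/andP=> klr ur /andP[kl lr]; have [q pq] := IH ur lr.
suff [q' qq'] : exists q', q = ('X_l - 'X_k) * q'.
  by exists q'; rewrite big_cons /= pq qq'; ring.
apply: collapse_dvd; have := p0 _ _ kl; rewrite {1}pq rmorphM /= => /eqP.
rewrite mulf_eq0 => /orP[|/eqP//]; rewrite rmorph_prod /= prodf_seq_eq0.
case/hasP=> -[i j] ijr /=; rewrite rmorphB /= !renameX.
have ij : (i < j)%N by have /allP/(_ _ ijr) := lr.
have ne : (i, j) != (k, l) by apply: contraNneq klr => <-.
(* The substitution identifies the variables of the pair (k, l) only, so the factors already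
   extracted stay nonzero and the quotient itself must vanish. *)
suff : collapse k l j != collapse k l i by move/mpolyX_sub_neq0/negPf->.
rewrite /collapse; case: (eqVneq j k) => [jk|jk]; case: (eqVneq i k) => [ik|ik].
- by rewrite jk ik ltnn in ij.
- by apply/eqP => li; rewrite jk -li in ij; have := ltn_trans ij kl; rewrite ltnn.
- by apply: contraNneq ne => jl; rewrite ik jl.
- by apply/eqP => ji; rewrite ji ltnn in ij.
Qed.

Definition vandermonde : {mpoly R[n]} :=
  \prod_(i < n) \prod_(j < n | (i < j)%N) ('X_j - 'X_i).

(** A permutation of the variables permutes the columns of the Vandermonde matrix. *)
Lemma rename_vandermonde (s : 'S_n) : rename s vandermonde = (-1) ^+ s * vandermonde.
Proof.
pose a : 'rV[{mpoly R[n]}]_n := \row_j 'X_j.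
have -> : vandermonde = \det (Vandermonde n a).
  rewrite det_Vandermonde; apply: eq_bigr => i _; apply: eq_bigr => j _.
  by rewrite !mxE.
rewrite -det_map_mx.
have -> : map_mx (rename s) (Vandermonde n a) = col_perm s (Vandermonde n a).
  by apply/matrixP => i j; rewrite !mxE rmorphXn /= renameX.
by rewrite col_permE det_mulmx det_perm mulrC odd_permV.
Qed.

Lemma vandermonde_neq0 : vandermonde != 0.
Proof.
apply/prodf_neq0 => i _; apply/prodf_neq0 => j ij; apply: mpolyX_sub_neq0.
by apply: contraTneq ij => ->; rewrite ltnn.
Qed.

(** Identifying two variables absorbs their transposition, so the image c of [p] satisfies c = -c
    and is 0 because 2 is nonzero. Each difference of variables therefore divides [p]. *)
Lemma antisym_dvd p : 2%:R != 0 :> R ->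
  (forall k l, k != l -> rename (tperm k l) p = - p) ->
  exists q, p = vandermonde * q.
Proof.
move=> two anti; pose r := [seq ij : 'I_n * 'I_n <- enum {: 'I_n * 'I_n} | (ij.1 < ij.2)%N].
have [||k l kl|q ->] := @collapse_prod_dvd p r.
- by rewrite filter_uniq ?enum_uniq.
- exact: filter_all.
- have := anti k l; rewrite neq_ltn kl => /(_ isT)/(congr1 (rename (collapse k l))).
  rewrite rmorphN /= (rename_comp (s'' := collapse k l)); last first.
    by move=> i /=; rewrite /collapse; case: tpermP => [->|->|/eqP/negPf-> //]; rewrite eqxx ?if_same.
  by move/eqP; rewrite -subr_eq0 opprK -mulr2n -mulr_natl -mpolyC_nat mulf_eq0 mpolyC_eq0 (negPf two) => /eqP ->.
exists q; congr (_ * _); rewrite /r big_filter big_enum_cond /= /vandermonde.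
by rewrite pair_big_dep.
Qed.

End Renaming.

Lemma prod_offdiag (R : comPzSemiRingType) n (G : 'I_n -> 'I_n -> R) :
  \prod_i \prod_(j | j != i) G i j =
  \prod_(i < n) \prod_(j < n | (i < j)%N) (G i j * G j i).
Proof.
under [RHS]eq_bigr do rewrite big_split.
rewrite big_split /= [X in _ = _ * X](exchange_big_dep xpredT) //= -big_split /=.
apply: eq_bigr => i _; rewrite (bigID (fun j : 'I_n => (i < j)%N)) /=.
congr (_ * _); apply: eq_bigl => j; rewrite -val_eqE /=; case: ltngtP => //.
Qed.

(** * Sums of Hall-Littlewood terms over a common denominator *)

Section HallLittlewoodFrac.
Variables (R : idomainType) (n : nat) (t : R).
Local Notation K := {fraction {mpoly R[n]}}.

Definition frac_var (i : 'I_n) : K := tofrac 'X_i.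
Definition frac_param : K := tofrac t%:MP.

Local Notation natf f := (fun i => nat_of_ord (f i)).
Local Notation hl f := (hl_on frac_param frac_var setT f).

Lemma frac_var_inj : injective frac_var.
Proof.
move=> i j /eqP; rewrite /frac_var tofrac_eq; apply: contraTeq => ij.
by rewrite -subr_eq0 mpolyX_sub_neq0.
Qed.

(** The product runs over ordered pairs, which makes it invariant under permutations of the
    variables; [hl_num f] is the numerator of the term of [f] over it. *)
Definition hl_den : {mpoly R[n]} := \prod_i \prod_(j | j != i) ('X_i - 'X_j).
Definition hl_num (f : 'I_n -> nat) : {mpoly R[n]} :=
  (\prod_i 'X_i ^+ f i) *
  \prod_i \prod_(j | j != i)
     (if (f j < f i)%N then 'X_i - t%:MP * 'X_j else 'X_i - 'X_j).

Lemma hl_den_neq0 : hl_den != 0.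
Proof.
apply/prodf_neq0 => i _; apply/prodf_neq0 => j ij.
by apply: mpolyX_sub_neq0; rewrite eq_sym.
Qed.

Lemma hl_num_frac f : tofrac (hl_num f) = tofrac hl_den * hl f.
Proof.
rewrite /hl_num /hl_on rmorphM /= rmorph_prod mulrCA; congr (_ * _).
  by rewrite [RHS]big_mkcond; apply: eq_bigr => i _; rewrite in_setT rmorphXn.
rewrite !rmorph_prod [\prod_(i in setT) _]big_mkcond -big_split; apply: eq_bigr => i _.
rewrite in_setT /= !rmorph_prod big_mkcond /= [X in _ = X * _]big_mkcond /=.
rewrite [X in _ = _ * X]big_mkcond -big_split; apply: eq_bigr => j _ /=.
rewrite in_setT /=; case: eqVneq => [->|ij]; first by rewrite ltnn /= mulr1.
case: ifP => _; last by rewrite /= mulr1.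
rewrite /frac_var /frac_param !rmorphB rmorphM /= mulrCA divff ?mulr1 //.
by rewrite -rmorphB tofrac_eq0 mpolyX_sub_neq0 // eq_sym.
Qed.

Lemma rename_hl_num (s : 'S_n) f : rename s (hl_num (f \o s)) = hl_num f.
Proof.
rewrite /hl_num rmorphM /= !rmorph_prod; congr (_ * _).
  rewrite [RHS](reindex_inj (@perm_inj _ s)); apply: eq_bigr => i _.
  by rewrite rmorphXn /= renameX.
rewrite [RHS](reindex_inj (@perm_inj _ s)); apply: eq_bigr => i _.
rewrite rmorph_prod [RHS](reindex_inj (@perm_inj _ s)) /=.
apply: eq_big => [j|j _]; first by rewrite (inj_eq perm_inj).
by case: ifP; rewrite rmorphB ?rmorphM /= !renameX ?renameC.
Qed.

(** For i < j, one of the two factors in [hl_num f] that belong to the pair is a difference of the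
    variables. It is removed here, with the sign that makes it ['X_j - 'X_i]. *)
Definition hl_anti (f : 'I_n -> nat) : {mpoly R[n]} :=
  (\prod_i 'X_i ^+ f i) *
  \prod_(i < n) \prod_(j < n | (i < j)%N)
     (if (f j < f i)%N then 'X_i - t%:MP * 'X_j
      else if (f i < f j)%N then t%:MP * 'X_i - 'X_j else 'X_i - 'X_j).

Lemma hl_num_anti f : hl_num f = vandermonde R n * hl_anti f.
Proof.
rewrite /hl_num prod_offdiag /hl_anti /vandermonde mulrCA; congr (_ * _).
rewrite -big_split; apply: eq_bigr => i _; rewrite -big_split; apply: eq_bigr => j _ /=.
by case: ltngtP => _; ring.
Qed.

Lemma hl_den_vandermonde : exists2 e : {mpoly R[n]}, e * e = 1 &
  hl_den = vandermonde R n * vandermonde R n * e.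
Proof.
exists (\prod_(i < n) \prod_(j < n | (i < j)%N) (-1)).
  rewrite -big_split big1 // => i _; rewrite -big_split big1 // => j _.
  by rewrite /= mulrNN mulr1.
rewrite /hl_den prod_offdiag /vandermonde -!big_split; apply: eq_bigr => i _.
by rewrite -!big_split; apply: eq_bigr => j _ /=; ring.
Qed.

Hypothesis two_neq0 : 2%:R != 0 :> R.

(* Over the symmetric denominator [hl_den], the square of the Vandermonde product up
   to a unit, the numerator is one Vandermonde product times an antisymmetric
   polynomial, which supplies the second one. *)
Lemma hl_sum_poly N (P : pred {ffun 'I_n -> 'I_N}) :
  (forall (s : 'S_n) (f : {ffun 'I_n -> 'I_N}), P [ffun i => f (s i)] = P f) ->
  exists p, tofrac p = \sum_(f | P f) hl (natf f).
Proof.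
move=> Psym; pose A := \sum_(f | P f) hl_anti (natf f).
pose W := \sum_(f | P f) hl_num (natf f).
have WA : W = vandermonde R n * A.
  by rewrite /A mulr_sumr; apply: eq_bigr => f _; rewrite hl_num_anti.
have Wsym (s : 'S_n) : rename s W = W.
  rewrite /W rmorph_sum.
  have bij : bijective (fun f : {ffun 'I_n -> 'I_N} => [ffun i => f (s i)]).
    exists (fun f : {ffun 'I_n -> 'I_N} => [ffun i => f ((s^-1)%g i)]) => f;
    by apply/ffunP => i; rewrite !ffunE ?permK ?permKV.
  rewrite (reindex _ (onW_bij _ bij)) /=; apply: eq_big => [f|f _]; first exact: Psym.
  rewrite -[RHS](rename_hl_num s); congr (rename _ (_ * _)).
    by apply: eq_bigr => i _; rewrite ffunE.
  by apply: eq_bigr => i _; apply: eq_bigr => j _; rewrite !ffunE.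
(* [W] is symmetric and the Vandermonde product antisymmetric, so the quotient [A] is
   antisymmetric. *)
have [k l kl|q Aq] := antisym_dvd (p := A) two_neq0.
  have := Wsym (tperm k l); rewrite WA rmorphM /= rename_vandermonde odd_tperm kl /=.
  rewrite expr1 mulN1r mulNr -mulrN => /(mulfI (vandermonde_neq0 R n)) e.
  by rewrite -[in RHS]e opprK.
have [e ee den] := hl_den_vandermonde; exists (e * q).
apply: (mulfI (_ : tofrac hl_den != 0)); first by rewrite tofrac_eq0 hl_den_neq0.
rewrite mulr_sumr; under eq_bigr do rewrite -hl_num_frac.
rewrite -rmorph_sum -/W WA Aq -rmorphM /= den; congr tofrac.
rewrite [RHS]mulrA -!mulrA; congr (_ * (_ * _)); by rewrite mulrA ee mul1r.
Qed.

(** * Cosets of the stabiliser and rearrangements of a partition *)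

Section Rearrangements.
Variable la : seq nat.
Local Notation part i := (nth 0%N la i).

Definition arrangement (f : 'I_n -> nat) (w : 'S_n) := [forall i, f (w i) == part i].
Definition rearr (f : 'I_n -> nat) := [exists w, arrangement f w].

Lemma hl_term_arrangement f w : arrangement f w -> hl_term la t w = hl f.
Proof.
move/forallP => fw; rewrite /hl_term /hl_on; congr (_ * _).
  rewrite [RHS](reindex_inj (@perm_inj _ w)); apply: eq_big => [i|i _].
    by rewrite in_setT.
  by rewrite (eqP (fw i)).
rewrite [RHS](reindex_inj (@perm_inj _ w)); apply: eq_big => [i|i _].
  by rewrite in_setT.
rewrite [RHS](reindex_inj (@perm_inj _ w)); apply: eq_big => [j|j _].
  by rewrite in_setT (eqP (fw i)) (eqP (fw j)).
by [].
Qed.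

Lemma rcoset_arrangement f w : arrangement f w ->
  (hl_stab n la :* w)%g = [set y | arrangement f y].
Proof.
move=> /forallP fw; apply/setP => y; rewrite mem_rcoset !inE.
have e i : part ((y * w^-1)%g i) = f (y i).
  by rewrite permM -(eqP (fw _)) permKV.
by apply: eq_forallb => i; rewrite e.
Qed.

(** A coset of the stabiliser consists of the permutations that carry the padded [la] to one given
    rearrangement. The bound [N] places the rearrangements in a finite type. *)
Lemma sum_rearr N : all (fun k => (k < N)%N) la -> (0 < N)%N -> (size la <= n)%N ->
  hl_rat n la t = \sum_(f : {ffun 'I_n -> 'I_N} | rearr (natf f)) hl (natf f).
Proof.
case: N => // N laN _ sla; rewrite /hl_rat sla.
have part_lt (i : 'I_n) : (part i < N.+1)%N.
  case: (ltnP i (size la)) => ila; last by rewrite nth_default.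
  by apply: (allP laN); rewrite mem_nth.
pose fC (C : {set 'S_n}) : {ffun 'I_n -> 'I_N.+1} :=
  [ffun i => inord (part (((repr C)^-1)%g i))].
have fCE C : arrangement (natf (fC C)) (repr C).
  by apply/forallP => i; rewrite ffunE permK inordK.
pose Cf (f : {ffun 'I_n -> 'I_N.+1}) := [set y | arrangement (natf f) y].
rewrite (reindex_onto fC Cf) /=; last first.
  move=> f /existsP[w fw].
  have /mem_repr : w \in Cf f by rewrite inE.
  rewrite inE => /forallP /= h; apply/ffunP => i; apply: val_inj.
  by rewrite ffunE /= inordK // -(eqP (h _)) permKV.
apply: eq_big => [C|C _]; last by rewrite (hl_term_arrangement (fCE C)).
apply/rcosetsP/andP => [[w _ Cw]|[/existsP[w fw] /eqP CE]].
  split; first by apply/existsP; exists (repr C); apply: fCE.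
  apply/eqP; rewrite [Cf _](esym (rcoset_arrangement (fCE C))).
  have wC : w \in C.
    by rewrite Cw mem_rcoset mulgV inE; apply/forallP => i; rewrite perm1.
  pose g (i : 'I_n) := part ((w^-1)%g i).
  have gw : arrangement g w by apply/forallP => i; rewrite /g permK.
  have CE : C = [set y | arrangement g y] by rewrite Cw (rcoset_arrangement gw).
  have := mem_repr _ wC; rewrite {2}CE inE => gr.
  by rewrite (rcoset_arrangement gr) -CE.
exists w; first by rewrite in_setT.
by rewrite -CE (rcoset_arrangement fw).
Qed.

(** Rearrangements are stable under permutation of the indices, so [hl_sum_poly] provides the
    polynomial that [hl_poly] chooses; with more parts than variables it is 0. *)
Lemma hl_poly_frac : tofrac (hl_poly n la t) = hl_rat n la t.
Proof.
rewrite /hl_poly; case: classical_sets.xgetP => [p -> //|] no; exfalso.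
suff [p hp] : exists p, tofrac p = hl_rat n la t by exact: (no p hp).
case: (leqP (size la) n) => sla; last first.
  by exists 0; rewrite /hl_rat leqNgt sla rmorph0.
rewrite (@sum_rearr (\max_(k <- la) k).+1) //; last first.
  by apply/allP => k kla; rewrite ltnS; apply: (leq_bigmax_seq k).
apply: hl_sum_poly => s f; apply/existsP/existsP => -[w /forallP h].
  by exists (w * s)%g; apply/forallP => i; rewrite permM; have := h i; rewrite ffunE.
exists (w * s^-1)%g; apply/forallP => i.
by rewrite ffunE permM permKV.
Qed.

End Rearrangements.
End HallLittlewoodFrac.

(** * Order of vanishing at the origin *)

(** ['X] is prime and does not divide [b], so its powers divide [a]. *)
Lemma mulXn_cancel (D : idomainType) (a b r : {poly D}) k :
  b`_0 != 0 -> a * b = 'X^k * r -> exists s, a = 'X^k * s.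
Proof.
move=> b0; elim: k a r => [|k IH] a r ab; first by exists a; rewrite mul1r.
have a0 : a`_0 = 0.
  have /eqP := congr1 (fun p : {poly D} => p`_0) ab.
  by rewrite /= coef0M exprS -mulrA coefXM /= mulf_eq0 (negPf b0) orbF => /eqP.
have [a' aE] : exists a', a = 'X * a'.
  have /factor_theorem[a' ->] : root a 0 by rewrite /root horner_coef0 a0.
  by exists a'; rewrite subr0 mulrC.
have [s sE] : exists s, a' = 'X^k * s.
  apply: (IH _ r); apply: (mulfI (_ : 'X != 0)); first by rewrite polyX_eq0.
  by rewrite mulrA -aE ab exprS mulrA.
by exists s; rewrite aE sE exprS mulrA.
Qed.

Section Valuation.
Variables (R : idomainType) (n : nat).
Implicit Types (p q : {mpoly R[n]}).
Local Notation K := {fraction {mpoly R[n]}}.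
Implicit Types e : K.

(** Each variable is multiplied by a new variable T; the coefficient of T^d is the homogeneous
    component of degree d. *)
Definition scaling : {mpoly R[n]} -> {poly {mpoly R[n]}} :=
  mmap (polyC \o @mpolyC n R) (fun i => ('X_i)%:P * 'X).

HB.instance Definition _ := GRing.RMorphism.copy scaling
  (mmap (polyC \o @mpolyC n R) (fun i => ('X_i)%:P * 'X)).

Lemma scalingC c : scaling c%:MP = (c%:MP)%:P.
Proof. by rewrite /scaling mmapC. Qed.

Lemma scalingX i : scaling 'X_i = ('X_i)%:P * 'X.
Proof. by rewrite /scaling mmapX mmap1U. Qed.

Lemma scaling_monom (m : 'X_{1..n}) : scaling 'X_[m] = ('X_[m])%:P * 'X^(mdeg m).
Proof.
rewrite /scaling mmapX /mmap1; under eq_bigr do rewrite exprMn.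
rewrite big_split /= mpolyXE_id rmorph_prod /=; congr (_ * _).
  by apply: eq_bigr => i _; rewrite rmorphXn.
by rewrite mdegE prodrXr.
Qed.

Lemma scaling_coef p m : (scaling p)`_(mdeg m) @_m = p@_m.
Proof.
rewrite [p in LHS]mpolyE rmorph_sum coef_sum raddf_sum /=.
rewrite [in RHS](mpolyE p) raddf_sum /=; apply: eq_bigr => m' _.
rewrite -mul_mpolyC rmorphM /= scalingC scaling_monom mulrA -rmorphM /= coefCM coefXn.
rewrite mul_mpolyC; have [->|ne] := eqVneq m' m; first by rewrite eqxx mulr1.
rewrite [RHS]mcoeffZ mcoeffX (negPf ne) mulr0.
by case: eqP => _; rewrite ?mulr1 ?mulr0 ?mcoeff0 // mcoeffZ mcoeffX (negPf ne) mulr0.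
Qed.

Definition order_ge k p := exists r, scaling p = 'X^k * r.

Lemma order_ge_coef k p (m : 'X_{1..n}) : order_ge k p -> (mdeg m < k)%N -> p@_m = 0.
Proof.
by move=> [r e] mk; rewrite -scaling_coef e coefXnM mk mcoeff0.
Qed.

(* [e] has a representation [p / q] with [q] of order [h] and [p] of order at
   least [k + h], the order being that of vanishing at the origin. *)
Definition val_ge k e := exists p q h r s,
  [/\ e = tofrac p / tofrac q, scaling q = 'X^h * s, s`_0 != 0
    & scaling p = 'X^(k + h) * r].

Lemma scaling_neq0 q h s : scaling q = 'X^h * s -> s`_0 != 0 -> tofrac q != 0.
Proof.
move=> qs s0; rewrite tofrac_eq0; apply: contraNneq s0 => q0.
have /esym/eqP := qs; rewrite q0 rmorph0 mulf_eq0 expf_eq0 polyX_eq0 andbF /=.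
by move/eqP->; rewrite coef0.
Qed.

Lemma val_ge_frac k p q h r s : scaling q = 'X^h * s -> s`_0 != 0 ->
  scaling p = 'X^(k + h) * r -> val_ge k (tofrac p / tofrac q).
Proof. by move=> qs s0 pr; exists p, q, h, r, s. Qed.

Lemma val_ge_poly k p r : scaling p = 'X^k * r -> val_ge k (tofrac p).
Proof.
move=> pr; rewrite -[tofrac p]divr1 -(rmorph1 (@tofrac {mpoly R[n]})).
apply: (val_ge_frac (h := 0) (s := 1) (r := r)); rewrite ?rmorph1 ?mul1r ?addn0 //.
by rewrite coef1 oner_eq0.
Qed.

Lemma val_geD k e e' : val_ge k e -> val_ge k e' -> val_ge k (e + e').
Proof.
move=> [p [q [h [r [s [-> qs s0 pr]]]]]] [p' [q' [h' [r' [s' [-> qs' s0' pr']]]]]].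
have qn := scaling_neq0 qs s0; have qn' := scaling_neq0 qs' s0'.
have -> : tofrac p / tofrac q + tofrac p' / tofrac q' =
    tofrac (p * q' + p' * q) / tofrac (q * q').
  rewrite tofracD !tofracM addf_div; [by [] | exact: qn | exact: qn'].
apply: (val_ge_frac (h := h + h') (s := s * s') (r := r * s' + r' * s)).
- by rewrite rmorphM /= qs qs' exprD; ring.
- by rewrite coef0M mulf_neq0.
- by rewrite rmorphD !rmorphM /= qs qs' pr pr' !exprD; ring.
Qed.

Lemma val_geM k l e e' : val_ge k e -> val_ge l e' -> val_ge (k + l) (e * e').
Proof.
move=> [p [q [h [r [s [-> qs s0 pr]]]]]] [p' [q' [h' [r' [s' [-> qs' s0' pr']]]]]].
rewrite mulrACA -invfM -!rmorphM /=.
apply: (val_ge_frac (h := h + h') (s := s * s') (r := r * r')).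
- by rewrite rmorphM /= qs qs' exprD; ring.
- by rewrite coef0M mulf_neq0.
- by rewrite rmorphM /= pr pr' !exprD; ring.
Qed.

Lemma val_ge0 k : val_ge k 0.
Proof. by rewrite -(rmorph0 (@tofrac {mpoly R[n]})); apply: (@val_ge_poly _ _ 0); rewrite rmorph0 mulr0. Qed.

Lemma val_geMl k e e' : val_ge 0 e -> val_ge k e' -> val_ge k (e * e').
Proof. exact: (@val_geM 0). Qed.

Lemma val_ge1 : val_ge 0 1.
Proof.
by rewrite -(rmorph1 (@tofrac {mpoly R[n]})); apply: (@val_ge_poly _ _ 1); rewrite rmorph1 mulr1.
Qed.

Lemma val_ge_sum k (I : Type) (r : seq I) (P : pred I) (F : I -> K) :
  (forall i, P i -> val_ge k (F i)) -> val_ge k (\sum_(i <- r | P i) F i).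
Proof. by move=> h; apply: big_ind => //; [exact: val_ge0 | exact: val_geD]. Qed.

Lemma val_ge_prod (I : Type) (r : seq I) (P : pred I) (F : I -> K) :
  (forall i, P i -> val_ge 0 (F i)) -> val_ge 0 (\prod_(i <- r | P i) F i).
Proof. by move=> h; apply: big_ind => //; [exact: val_ge1 | exact: val_geMl]. Qed.

Lemma val_geC c : val_ge 0 (tofrac c%:MP).
Proof. by apply: (@val_ge_poly _ _ (c%:MP)%:P); rewrite scalingC mul1r. Qed.

Lemma val_geX i : val_ge 1 (frac_var R i).
Proof. by apply: (@val_ge_poly _ _ ('X_i)%:P); rewrite scalingX mulrC. Qed.

Lemma val_ge_prodX k (U : {set 'I_n}) e : U != set0 -> val_ge k e ->
  val_ge k.+1 ((\prod_(i in U) frac_var R i) * e).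
Proof.
move=> /set0Pn[i iU] ke; rewrite (big_setD1 i iU) /= -mulrA.
apply: (@val_geM 1); first exact: val_geX.
apply: val_geMl => //; apply: val_ge_prod => j _.
by apply: (@val_ge_poly _ _ (('X_j)%:P * 'X)); rewrite scalingX mul1r.
Qed.

(** The quotients (x_i - t x_j) / (x_i - x_j) have no power series expansion at the origin, but
    numerator and denominator are homogeneous of degree 1, which is why orders are taken on
    fractions. *)
Lemma val_ge_psi t (A B : {set 'I_n}) : [disjoint A & B] -> val_ge 0 (psi (frac_param n t) (@frac_var R n) A B).
Proof.
move=> d; apply: val_ge_prod => i iA; apply: val_ge_prod => j jB.
have ij : i != j by apply: contraTneq iA => ->; rewrite (disjointFl d jB).
rewrite /frac_var /frac_param -rmorphM -!rmorphB /=.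
apply: (val_ge_frac (h := 1) (s := ('X_i - 'X_j)%:P) (r := ('X_i - t%:MP * 'X_j)%:P)).
- by rewrite !rmorphB /= !scalingX; ring.
- by rewrite coefC mpolyX_sub_neq0.
- by rewrite !(rmorphB, rmorphM) /= !scalingX scalingC; ring.
Qed.

Lemma val_ge_pair t i j :
  val_ge 0 ((1 - frac_param n t * (frac_var R i * frac_var R j)) / (1 - frac_var R i * frac_var R j)).
Proof.
rewrite /frac_var /frac_param -!rmorphM -!(rmorph1 (@tofrac {mpoly R[n]})) -!rmorphB /=.
apply: (val_ge_frac (h := 0) (s := 1 - ('X_i * 'X_j)%:P * 'X^2)
  (r := 1 - (t%:MP * 'X_i * 'X_j)%:P * 'X^2)).
- by rewrite rmorphB rmorph1 rmorphM /= !scalingX rmorphM; ring.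
- by rewrite coefB coef1 coefCM coefXn mulr0 subr0 oner_eq0.
- by rewrite rmorphB rmorph1 !rmorphM /= !scalingX scalingC; ring.
Qed.

(** Brings the estimates back from fractions to polynomials: the lowest component of the denominator
    is nonzero and cannot absorb a power of T. *)
Lemma val_ge_order k p : val_ge k (tofrac p) -> order_ge k p.
Proof.
move=> [p' [q [h [r [s [pe qs s0 pr]]]]]].
have qn := scaling_neq0 qs s0.
have {}pe : p * q = p'.
  by apply/eqP; rewrite -tofrac_eq rmorphM /= pe divfK.
apply: (mulXn_cancel s0 (r := r)); apply: (mulfI (_ : 'X^h != 0 :> {poly {mpoly R[n]}})).
  by rewrite expf_eq0 polyX_eq0 andbF.
by rewrite mulrCA -qs -rmorphM pe /= pr exprD; ring.
Qed.

End Valuation.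

(** * The identity for rational functions in n variables *)

Lemma prod_pairsU1 (R : comPzSemiRingType) n (g : 'I_n -> 'I_n -> R) i (V : {set 'I_n}) :
  (forall j k, g j k = g k j) -> i \notin V ->
  \prod_(j in i |: V) \prod_(k in i |: V | (j < k)%N) g j k =
  (\prod_(j in V) g i j) * \prod_(j in V) \prod_(k in V | (j < k)%N) g j k.
Proof.
move=> gC iV; rewrite big_setU1 //= big_mkcondr big_setU1 //= ltnn mul1r.
under [X in _ * X]eq_bigr do rewrite big_mkcondr big_setU1 //= -big_mkcondr.
rewrite big_split /= mulrA; congr (_ * _); rewrite -big_split; apply: eq_bigr => j jV /=.
have : i != j by apply: contraNneq iV => ->.
by rewrite -val_eqE /=; case: ltngtP; rewrite ?mulr1 ?mul1r.
Qed.

Lemma rs_rmorph (R S : pzRingType) (f : {rmorphism R -> S}) t m a b :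
  f (rs t m a b) = rs (f t) m (f a) (f b).
Proof.
elim: m b => [|m IH] b /=; first exact: rmorph1.
by rewrite rmorphD !rmorphM /= !IH rmorphM.
Qed.

Section LittlewoodFrac.
Variables (R : idomainType) (n : nat) (t : R).
Hypothesis two_neq0 : 2%:R != 0 :> R.
Local Notation K := {fraction {mpoly R[n]}}.
Local Notation x := (@frac_var R n).
Local Notation tt := (frac_param n t).
Local Notation fc c := (@tofrac {mpoly R[n]} c%:MP).
Implicit Types (U V I : {set 'I_n}) (phi : {set 'I_n} -> K).

Definition Phi U : K := (\prod_(i in U) (1 - x i * x i)^-1) *
  \prod_(i in U) \prod_(j in U | (i < j)%N) ((1 - tt * (x i * x j)) / (1 - x i * x j)).

Lemma frac_var_neq0 i : x i != 0.
Proof.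
rewrite tofrac_eq0; apply/eqP => /(congr1 (mcoeff U_(i)%MM))/eqP.
by rewrite mcoeffXU eqxx mcoeff0 oner_eq0.
Qed.

Lemma frac_var_gen i j : x i * x j != 1.
Proof.
rewrite -(rmorph1 (@tofrac {mpoly R[n]})) -rmorphM /= tofrac_eq.
apply/eqP => /(congr1 (mcoeff 0%MM))/eqP.
rewrite mcoeff1 eqxx -mpolyXD mcoeffX.
have -> : (U_(i) + U_(j) == 0 :> 'X_{1..n})%MM = false.
  by rewrite -mdeg_eq0 mdegD !mdeg1.
by rewrite eq_sym oner_eq0.
Qed.

Lemma frac_two_neq0 : 2%:R != 0 :> K.
Proof.
by rewrite -(rmorph_nat (@tofrac {mpoly R[n]})) tofrac_eq0 -mpolyC_nat mpolyC_eq0.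
Qed.

Lemma Phi0 : Phi set0 = 1.
Proof. by rewrite /Phi !big_set0 mulr1. Qed.

Lemma PhiU1 i V : i \notin V -> Phi (i |: V) =
  Phi V / (1 - x i * x i) * \prod_(j in V) ((1 - tt * (x i * x j)) / (1 - x i * x j)).
Proof.
move=> iV; rewrite /Phi prod_pairsU1 // => [|j k]; last by rewrite [x j * _]mulrC.
by rewrite big_setU1 //=; ring.
Qed.

Lemma Phi_rec U :
  \sum_(I : {set 'I_n} | I \subset U)
    (\prod_(i in I) x i) ^+ 2 * Phi I * psi tt x I (U :\: I) = Phi U.
Proof.
apply: (@sum_Littlewood _ _ tt x (@frac_var_inj R n) Phi frac_var_neq0 frac_var_gen frac_two_neq0 Phi0 PhiU1
  (fun A => (\prod_(i in A) x i) ^+ 2 * Phi A)).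
  by rewrite big_set0 expr1n mul1r Phi0.
move=> i V iV; rewrite PhiU1 // big_setU1 //=.
by set p := (\prod_(j in V) (_ / _)); ring.
Qed.

Lemma val_ge_inv i j : @val_ge R n 0 ((1 - x i * x j)^-1).
Proof.
have := @val_ge_pair R n 0 i j.
by rewrite /frac_param mpolyC0 rmorph0 mul0r subr0 mul1r.
Qed.

Lemma val_ge_Phi U : val_ge 0 (Phi U).
Proof.
apply: val_geMl; apply: val_ge_prod => i _; first exact: val_ge_inv.
by apply: val_ge_prod => j _; apply: val_ge_pair.
Qed.

Lemma val_geB k (e e' : K) : val_ge k e -> val_ge k e' -> val_ge k (e - e').
Proof.
move=> h h'; apply: val_geD => //; rewrite -mulN1r; apply: val_geMl => //.
by rewrite -(rmorph1 (@tofrac {mpoly R[n]})) -rmorphN -mpolyC1 -mpolyCN; apply: val_geC.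
Qed.

Lemma val_ge_Lop k (om : nat -> K) phi U : (forall m, val_ge 0 (om m)) ->
  (forall I, val_ge k (phi I)) -> val_ge k (Lop tt x om phi U).
Proof.
move=> h h'; apply: val_ge_sum => I IU; apply: val_geMl => //; apply: val_geMl => //.
by apply: val_ge_psi; rewrite -setI_eq0 setDE setICA setICr setI0.
Qed.

(** A nonempty product of variables gains one order. On the empty set nothing is gained, hence the
    condition there. *)
Lemma val_ge_Xop k phi U : phi set0 = 0 -> (forall I, val_ge k (phi I)) ->
  val_ge k.+1 (Xop x phi U).
Proof.
move=> p0 pk; have [->|U0] := eqVneq U set0; last exact: val_ge_prodX.
by rewrite /Xop p0 mulr0; apply: val_ge0.
Qed.

Lemma LopB (om : nat -> K) phi phi' U :
  Lop tt x om phi U - Lop tt x om phi' U = Lop tt x om (fun I => phi I - phi' I) U.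
Proof. by rewrite /Lop -sumrB; apply: eq_bigr => I _; rewrite mulrBr. Qed.

Lemma XopB phi phi' U : Xop x phi U - Xop x phi' U = Xop x (fun I => phi I - phi' I) U.
Proof. by rewrite /Xop mulrBr. Qed.

Lemma Lop_set0 (om : nat -> K) phi : Lop tt x om phi set0 = om 0%N * phi set0.
Proof. by rewrite /Lop sum_sub0 setD0 cards0 psi0l mulr1. Qed.

Lemma Xop_set0 phi : Xop x phi set0 = phi set0.
Proof. by rewrite /Xop big_set0 mul1r. Qed.

Lemma val_ge_pow_weight (c : K) m : val_ge 0 c -> val_ge 0 (pow_weight c m).
Proof.
move=> c0; rewrite /pow_weight; elim: m => [|m IH]; first exact: val_ge1.
by rewrite exprS; apply: val_geMl.
Qed.

Lemma Phi_Lop U : Phi U = Lop tt x (pow_weight 1) (Xop x (Xop x Phi)) U.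
Proof.
rewrite -Phi_rec; apply: eq_bigr => I _; rewrite /pow_weight expr1n /Xop; ring.
Qed.

Lemma littlewood_set0 k : littlewood_trunc tt x k set0 = 1.
Proof.
elim: k => [|k IH] /=; first by rewrite /delta0 eqxx.
by rewrite Lop_set0 !Xop_set0 IH mulr1.
Qed.

(** [Phi] is fixed by the operator that is iterated in [littlewood_trunc], and the difference
    vanishes at [set0]; each iteration contains two [Xop] and gains two orders. *)
Lemma littlewood_approx k U : val_ge (2 * k) (littlewood_trunc tt x k U - Phi U).
Proof.
elim: k U => [|k IH] U.
  apply: val_geB; last exact: val_ge_Phi.
  rewrite /= /delta0; case: eqP => _; [exact: val_ge1 | exact: val_ge0].
rewrite Phi_Lop /= LopB mulnS; apply: val_ge_Lop => [m|I].
  exact/val_ge_pow_weight/val_ge1.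
rewrite XopB; apply: val_ge_Xop => [|J].
  by rewrite !Xop_set0 littlewood_set0 Phi0 subrr.
rewrite XopB; apply: val_ge_Xop => //.
by rewrite littlewood_set0 Phi0 subrr.
Qed.

Lemma chain_approx (om : nat -> nat -> K) N phi phi' U :
  (forall l m, val_ge 0 (om l m)) -> phi set0 = phi' set0 ->
  (forall I, val_ge 0 (phi I - phi' I)) ->
  val_ge N (chain tt x om N phi U - chain tt x om N phi' U).
Proof.
move=> om0 p0 pI; elim: N om om0 U => //= N IH om om0 U.
rewrite LopB; apply: val_ge_Lop => // I; rewrite XopB; apply: val_ge_Xop => [|J].
  apply/eqP; rewrite subr_eq0; apply/eqP.
  elim: N (fun l => om l.+1) {IH} => //= N IH om'.
  by rewrite !Lop_set0 !Xop_set0 IH.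
by apply: IH.
Qed.

Variables a b : R.
Local Notation A := (fc a).
Local Notation B := (fc b).

(** The values of [part_weight] before passage to the fraction field, see [part_weight_frac]. *)
Definition level_coef (l : nat) (m : nat) : R :=
  if l is 0 then 1 else if odd l then rs t m a b else rs t m (a * b) 1.

Lemma level_coef0 l : level_coef l 0 = 1.
Proof. by rewrite /level_coef; case: l => // l; case: (odd l.+1). Qed.

Lemma part_weight_frac l m : part_weight tt A B l m = fc (level_coef l m).
Proof.
have f_rs c d : rs tt m (fc c) (fc d) = fc (rs t m c d).
  by rewrite -(rs_rmorph (@tofrac {mpoly R[n]} \o @mpolyC n R)).
case: l => [|l]; first by rewrite /= /pow_weight expr1n mpolyC1 rmorph1.
rewrite /part_weight /level_weight /level_coef; case: (odd l.+1); first exact: f_rs.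
by rewrite -f_rs mpolyC1 rmorph1 mpolyCM rmorphM.
Qed.

Definition Ysum : K := \prod_i ((1 + A * x i) * (1 + B * x i)).

Lemma littlewood_frac k :
  val_ge (2 * k.+1)
   (\sum_(f : {ffun 'I_n -> 'I_(2 * k.+1).+1})
       fc (\prod_(l < (2 * k.+1).+1) level_coef l #|[set i | f i == l :> nat]|) *
       hl_on tt x setT (fun i => f i : nat)
    - Ysum * Phi setT).
Proof.
set N := (2 * k.+1)%N.
have -> : \sum_(f : {ffun 'I_n -> 'I_N.+1})
    fc (\prod_(l < N.+1) level_coef l #|[set i | f i == l :> nat]|) *
       hl_on tt x setT (fun i => f i : nat) =
    chain tt x (part_weight tt A B) N
       (Lop tt x (part_weight tt A B N) (@delta0 K 'I_n)) setT.
  rewrite chain_sum; apply: eq_big => [f|f _].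
    by apply/esym/forallP => i; rewrite in_setT.
  congr (_ * _); rewrite /weight_on !rmorph_prod /=; apply: eq_bigr => l _.
  rewrite part_weight_frac; congr (fc (level_coef l #|pred_of_set _|)).
  by apply/setP => i; rewrite !inE.
(* The sum over functions ends with the weight of level [N], the chain obtained from
   [Yop_littlewood] with the powers of ab. The ends agree at [set0], so the two chains differ by
   order [N] only. *)
set phi := Lop _ _ _ _; pose phi' := Lop tt x (pow_weight (A * B)) (@delta0 K 'I_n).
have om0 l m : val_ge 0 (part_weight tt A B l m).
  by rewrite part_weight_frac; apply: val_geC.
have d0 I : val_ge 0 (@delta0 K 'I_n I).
  by rewrite /delta0; case: eqP => _; [exact: val_ge1 | exact: val_ge0].
have -> : chain tt x (part_weight tt A B) N phi setT - Ysum * Phi setT =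
   (chain tt x (part_weight tt A B) N phi setT
    - chain tt x (part_weight tt A B) N phi' setT)
   + Ysum * (littlewood_trunc tt x k.+1 setT - Phi setT).
  have -> : chain tt x (part_weight tt A B) N phi' setT =
      Ysum * littlewood_trunc tt x k.+1 setT.
    rewrite -(Yop_littlewood tt (@frac_var_inj R n) frac_var_neq0) /Yop mulrA -big_split.
    by congr (_ * _); apply: eq_bigl => i; rewrite in_setT.
  by rewrite mulrBr addrA subrK.
apply: val_geD.
  apply: chain_approx => // [|I].
    by rewrite /phi /phi' !Lop_set0 part_weight_frac level_coef0 /pow_weight expr0 mpolyC1 tofrac1.
  apply: val_geB; apply: val_ge_Lop => // m; apply: val_ge_pow_weight.
  by apply: val_geMl; apply: val_geC.
apply: val_geMl; last exact: littlewood_approx.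
have lin c i : val_ge 0 (1 + fc c * x i).
  apply: val_geD; first exact: val_ge1.
  apply: val_geMl; first exact: val_geC.
  by apply: (@val_ge_poly _ _ _ _ (('X_i)%:P * 'X)); rewrite scalingX mul1r.
by apply: val_ge_prod => i _; apply: val_geMl; apply: lin.
Qed.

End LittlewoodFrac.

(** * Grouping by partitions *)

Section Partitions.
Variable n : nat.
Implicit Types (la : seq nat).

Local Notation natf f := (fun i => nat_of_ord (f i)).

Definition values (f : 'I_n -> nat) : seq nat := [seq f i | i <- enum 'I_n].

Definition shape (f : 'I_n -> nat) : seq nat := sort geq [seq k <- values f | k != 0%N].

Lemma geq_trans : transitive geq.
Proof. by move=> y x z yx zy; apply: leq_trans zy yx. Qed.

Lemma geq_total : total geq.
Proof. by move=> x y; apply: leq_total. Qed.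

Lemma geq_anti : antisymmetric geq.
Proof. by move=> x y; rewrite andbC => /anti_leq. Qed.

Lemma shape_intpart f : is_intpart (shape f).
Proof.
rewrite /is_intpart sort_sorted; last exact: geq_total.
by rewrite mem_sort mem_filter.
Qed.

Lemma size_shape f : (size (shape f) <= n)%N.
Proof.
by rewrite size_sort size_filter (leq_trans (count_size _ _)) // size_map size_enum_ord.
Qed.

Lemma values_part la : (size la <= n)%N ->
  values (fun i => nth 0%N la i) = la ++ nseq (n - size la) 0%N.
Proof.
move=> sla; rewrite /values -[RHS](mkseq_nth 0%N) size_cat size_nseq subnKC //.
rewrite /mkseq -val_enum_ord -map_comp; apply: eq_map => i /=.
rewrite nth_cat nth_nseq; case: ifP => // /negbT; rewrite -leqNgt => h.
by rewrite if_same nth_default.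
Qed.

(** Either side says that the values of [f] are, up to order, the parts of [la] followed by
    zeros. *)
Lemma rearr_shape la f : is_intpart la -> (size la <= n)%N ->
  rearr la f = (shape f == la).
Proof.
move=> /andP[sorted_la la0] sla.
have filt : [seq k <- la | k != 0%N] = la.
  by apply/all_filterP/allP => k kla; apply: contraNneq la0 => <-.
apply/existsP/eqP => [[w /forallP fw]|fla].
  have vals : perm_eq (values f) (la ++ nseq (n - size la) 0%N).
    rewrite -values_part //.
    have -> : values (fun i => nth 0%N la i) = [seq f i | i <- [seq w i | i <- enum 'I_n]].
      by rewrite -map_comp; apply: eq_map => i /=; rewrite -(eqP (fw i)).
    apply: perm_map; apply: uniq_perm; rewrite ?enum_uniq //.
      by rewrite map_inj_uniq ?enum_uniq //; apply: perm_inj.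
    move=> i; rewrite mem_enum; apply/esym/mapP.
    by exists ((w^-1)%g i); rewrite ?mem_enum ?permKV.
  rewrite /shape -[RHS](sorted_sort geq_trans sorted_la).
  apply/(perm_sortP geq_total geq_trans geq_anti); rewrite -filt.
  have := perm_filter (fun k => k != 0%N) vals; rewrite filter_cat.
  by rewrite (_ : [seq k <- nseq _ _ | _] = [::]) ?cats0 //; elim: (n - size la)%N.
have vals : perm_eq (values (fun i => nth 0%N la i)) (values f).
  rewrite values_part //.
  rewrite perm_sym -(perm_filterC (fun k => k != 0%N) (values f)).
  have : perm_eq [seq k <- values f | k != 0%N] la by rewrite -fla perm_sym perm_sort.
  move=> pla; apply: perm_cat => //.
  have -> : (n - size la)%N = count (predC (fun k => k != 0%N)) (values f).
    rewrite -(perm_size pla) size_filter.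
    rewrite -[in LHS](size_enum_ord n) -(size_map f) -/(values f).
    by rewrite -(count_predC (fun k => k != 0%N) (values f)) addKn.
  rewrite -size_filter; set s := filter _ _.
  have /all_pred1P -> : all (pred1 0%N) s.
    by apply/allP => k; rewrite mem_filter /= negbK => /andP[].
  by rewrite size_nseq.
have vt : values f = [tuple f i | i < n] by rewrite /= /values.
rewrite vt in vals; have /tuple_permP[w hw] := vals.
exists w; apply/forallP => i; apply/eqP.
have := congr1 (fun s => nth 0%N s i) hw.
rewrite /values (nth_map i) ?size_enum_ord // nth_ord_enum => ->.
by rewrite -tnth_nth tnth_mktuple tnth_mktuple.
Qed.

Definition shapeP f : intpart := Sub (shape f) (shape_intpart f).

Lemma count_shape f l : l != 0%N -> count_mem l (shape f) = #|[set i | f i == l]|.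
Proof.
move=> l0; rewrite /shape count_sort count_filter /values count_map cardsE cardE.
rewrite [X in _ = size X]/enum_mem size_filter -enumT.
apply: eq_count => i /=; rewrite [RHS]/in_mem /= -[eqn _ _]/(f i == l).
by case: eqVneq => [->|] //=; rewrite l0.
Qed.

Definition shapes N : {fset intpart} :=
  [fset shapeP (natf (f : {ffun 'I_n -> 'I_N.+1})) | f : {ffun 'I_n -> 'I_N.+1}]%fset.

Lemma mem_shapes N (la : intpart) : (size (val la) <= n)%N ->
  all (fun k => (k < N.+1)%N) (val la) -> la \in shapes N.
Proof.
move=> sla laN; apply/imfsetP => /=; exists [ffun i : 'I_n => inord (nth 0%N (val la) i)] => //.
apply: val_inj => /=; apply/esym/eqP; rewrite -rearr_shape ?(valP la) //.
apply/existsP; exists 1%g; apply/forallP => i; rewrite perm1 ffunE inordK //.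
case: (ltnP i (size (val la))) => ila; last by rewrite nth_default.
by apply: (allP laN); rewrite mem_nth.
Qed.

(** * The truncated identity between polynomials *)

Section Weights.
Variables (R : idomainType) (t a b : R).
Hypothesis two_neq0 : 2%:R != 0 :> R.
Local Notation K := {fraction {mpoly R[n]}}.
Local Notation x := (@frac_var R n).
Local Notation tt := (frac_param n t).

Definition part_coef la : R := \prod_(l <- undup la) level_coef t a b l (count_mem l la).

(** Level 0 and the empty levels contribute the factor 1, so only the levels occurring as parts
    remain. *)
Lemma part_coef_shape N (f : 'I_n -> nat) : (forall i, (f i < N)%N) ->
  \prod_(l < N) level_coef t a b l #|[set i | f i == l]| = part_coef (shape f).
Proof.
move=> fN; transitivity (\prod_(l < N) level_coef t a b l (count_mem (l : nat) (shape f))).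
  apply: eq_bigr => -[[|l] lN] _ //=; by rewrite count_shape.
rewrite -(big_mkord xpredT (fun l => level_coef t a b l (count_mem l (shape f)))).
rewrite (bigID (mem (shape f))) /= [X in _ * X]big1 ?mulr1; last first.
  by move=> l /count_memPn->; rewrite level_coef0.
rewrite -big_filter; apply: perm_big; apply: uniq_perm.
- by rewrite filter_uniq // iota_uniq.
- exact: undup_uniq.
move=> l; rewrite mem_filter mem_undup mem_index_iota /= andb_idr //.
rewrite mem_sort mem_filter => /andP[_ /mapP[i _ ->]]; exact: fN.
Qed.

(** Functions are grouped by their shape; those of shape [la] are its rearrangements and add up to
    the Hall-Littlewood polynomial. *)
Lemma sum_shapes N :
  \sum_(f : {ffun 'I_n -> 'I_N.+1})
     tofrac (\prod_(l < N.+1) level_coef t a b l #|[set i | f i == l :> nat]|)%:MP *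
     hl_on tt x setT (fun i => f i : nat) =
  tofrac (\sum_(la <- shapes N) (part_coef (val la)) *: hl_poly n (val la) t).
Proof.
transitivity (\sum_(f : {ffun 'I_n -> 'I_N.+1}) \sum_(la <- shapes N | shapeP (natf f) == la)
    tofrac (part_coef (val la))%:MP * hl_on tt x setT (natf f)).
  apply: eq_bigr => f _; rewrite (@part_coef_shape N.+1 (natf f)) //.
  rewrite -big_filter (perm_big [:: shapeP (natf f)]) ?big_seq1 //.
  apply: uniq_perm => //; first by rewrite filter_uniq ?fset_uniq.
  move=> la; rewrite mem_filter inE eq_sym andb_idr // => /eqP->.
  by apply/imfsetP; exists f.
rewrite (exchange_big_dep xpredT) //= rmorph_sum big_seq [RHS]big_seq.
apply: eq_bigr => la /imfsetP[g _ laE].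
rewrite -mul_mpolyC [RHS]rmorphM -mulr_sumr; congr (_ * _).
have sla : (size (val la) <= n)%N by rewrite laE size_shape.
rewrite [RHS]hl_poly_frac // (@sum_rearr _ _ _ _ N.+1) //; last first.
  apply/allP => k; rewrite laE mem_sort mem_filter => /andP[_ /mapP[i _ ->]].
  exact: ltn_ord.
by apply: eq_bigl => f; rewrite rearr_shape ?(valP la) // -val_eqE.
Qed.

Definition prod_num : {mpoly R[n]} :=
  (\prod_i ((1 + a *: 'X_i) * (1 + b *: 'X_i))) *
  \prod_(i < n) \prod_(j < n | (i < j)%N) (1 - t *: ('X_i * 'X_j)).
Definition prod_den : {mpoly R[n]} :=
  (\prod_i ((1 - 'X_i) * (1 + 'X_i))) *
  \prod_(i < n) \prod_(j < n | (i < j)%N) (1 - 'X_i * 'X_j).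

Lemma prod_frac : tofrac prod_num = tofrac prod_den * (Ysum n a b * Phi t setT).
Proof.
have nz i j : 1 - x i * x j != 0 by rewrite subr_eq0 eq_sym frac_var_gen.
pose d1 := \prod_i (1 - x i * x i).
pose d2 := \prod_(i < n) \prod_(j < n | (i < j)%N) (1 - x i * x j).
pose m := \prod_(i < n) \prod_(j < n | (i < j)%N) (1 - tt * (x i * x j)).
have d1nz : d1 != 0 by apply/prodf_neq0 => i _; exact: nz.
have d2nz : d2 != 0 by apply/prodf_neq0 => i _; apply/prodf_neq0 => j _; exact: nz.
have num : tofrac prod_num = Ysum n a b * m.
  rewrite [LHS]rmorphM /= !rmorph_prod; congr (_ * _); apply: eq_bigr => i _.
    by rewrite -!mul_mpolyC [LHS]rmorphM !rmorphD !rmorph1 !rmorphM.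
  rewrite rmorph_prod; apply: eq_bigr => j _.
  by rewrite -mul_mpolyC [LHS]rmorphB rmorph1 !rmorphM.
have den : tofrac prod_den = d1 * d2.
  rewrite [LHS]rmorphM /= !rmorph_prod; congr (_ * _); apply: eq_bigr => i _.
    rewrite [LHS]rmorphM rmorphB rmorphD rmorph1 /= -/(frac_var R i).
    by move: (frac_var R i) => z; ring.
  rewrite rmorph_prod; apply: eq_bigr => j _.
  by rewrite [LHS]rmorphB rmorph1 rmorphM.
have phi : Phi t setT = d1^-1 * (m / d2).
  rewrite /Phi -prodfV; congr (_ * _).
    by apply: eq_bigl => i; rewrite in_setT.
  rewrite -prodfV -big_split; apply: eq_big => [i|i _]; first by rewrite in_setT.
  by rewrite -prodfV -big_split; apply: eq_bigl => j; rewrite in_setT.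
have alg (F : fieldType) (z1 z2 z3 z4 : F) : z1 != 0 -> z2 != 0 ->
    z4 * z3 = z1 * z2 * (z4 * (z1^-1 * (z3 / z2))).
  by move=> nz1 nz2; field; rewrite nz1 nz2.
rewrite num den phi; exact: (alg _ _ _ _ _ d1nz d2nz).
Qed.

Lemma val_ge_poly0 p : @val_ge R n 0 (tofrac p).
Proof. by apply: (@val_ge_poly _ _ _ _ (scaling p)); rewrite mul1r. Qed.

(** Clearing the denominator [prod_den] leaves polynomials, for which the estimate [littlewood_frac]
    bounds the order of vanishing. *)
Lemma sum_shapes_order k :
  order_ge (2 * k.+1) (prod_den *
    (\sum_(la <- shapes (2 * k.+1)) (part_coef (val la)) *: hl_poly n (val la) t)
    - prod_num).
Proof.
apply: val_ge_order; rewrite tofracB tofracM -sum_shapes prod_frac -mulrBr.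
by apply: val_geMl; [exact: val_ge_poly0 | exact: littlewood_frac].
Qed.

Lemma val_ge_hl_on M (f : 'I_n -> nat) i : (M <= f i)%N -> val_ge M (hl_on tt x setT f).
Proof.
move=> Mf; rewrite /hl_on mulrC; apply: val_geMl.
  apply: val_ge_prod => j _; apply: val_ge_prod => k /andP[_ jk].
  have := @val_ge_psi R n t [set j] [set k]; rewrite psi1l big_set1; apply.
  by rewrite disjoints1 inE; apply: contraTneq jk => ->; rewrite ltnn.
rewrite (big_setD1 i) ?in_setT //= mulrC; apply: val_geMl.
  by apply: val_ge_prod => j _; rewrite -rmorphXn; apply: val_ge_poly0.
rewrite -[x i]/(tofrac 'X_i) -tofracXn.
apply: (@val_ge_poly _ _ _ _ (('X_i ^+ f i)%:P * 'X^(f i - M))).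
rewrite rmorphXn /= scalingX exprMn rmorphXn /= mulrCA -exprD subnKC //.
Qed.

(** Every rearrangement takes the large value at some index, so every term contains a variable to a
    power at least [M]. *)
Lemma hl_poly_order M (la : intpart) : ~~ all (fun k => (k < M)%N) (val la) ->
  order_ge M (hl_poly n (val la) t).
Proof.
move=> /allPn[k kla Mk]; rewrite -leqNgt in Mk.
apply: val_ge_order; rewrite hl_poly_frac //.
have [sla|sla] := leqP (size (val la)) n; last first.
  by rewrite /hl_rat leqNgt sla; apply: val_ge0.
rewrite (@sum_rearr _ _ _ _ (\max_(k <- val la) k).+1) //; last first.
  by apply/allP => l lla; rewrite ltnS; apply: (leq_bigmax_seq l).
apply: val_ge_sum => f /existsP[w /forallP fw].
have ila : (index k (val la) < n)%N by apply: leq_trans sla; rewrite index_mem.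
apply: (val_ge_hl_on (i := w (Ordinal ila))).
by rewrite (eqP (fw _)) /= nth_index.
Qed.

End Weights.
End Partitions.

(** * Truncation of power series *)

Lemma mset_count (u : monom) x : u x = count_mem x (enum_mset u).
Proof. by rewrite -{1}[u]seq_mset_id mset_seqE. Qed.

Lemma mon_width_lt (u : monom) x : (0 < u x)%N -> (x < mon_width u)%N.
Proof.
rewrite mset_count -has_count => /hasP[y yu /eqP <-].
exact: (leq_bigmax_seq y).
Qed.

Lemma mon_width_le (u : monom) n :
  (forall x, (0 < u x)%N -> (x < n)%N) -> (mon_width u <= n)%N.
Proof.
move=> h; rewrite /mon_width big_seq; apply: (big_ind (fun k => k <= n)%N) => //.
  by move=> j k jn kn; rewrite geq_max jn kn.
by move=> x xu; apply: h; rewrite mset_count -has_count; apply/hasP; exists x; rewrite /= ?eqxx.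
Qed.

Lemma mon_width_sub (u v : monom) n : (forall x, (v x <= u x)%N) ->
  (mon_width u <= n)%N -> (mon_width v <= n)%N.
Proof.
move=> vu un; apply: mon_width_le => x vx; apply: leq_trans un; apply: mon_width_lt.
exact: leq_trans vx (vu x).
Qed.

Section Ideal.
Variables (R : comUnitRingType) (n : nat).
Implicit Types f g h : fps R.

(** Monomials of degree below [k] in the first [n] variables. They are closed under divisors, hence
    the series without such monomials form an ideal, which is [vanish k]. *)
Definition low_mon k (u : monom) := (mon_width u <= n)%N && (\sum_(i < n) u i < k)%N.
Definition vanish k f := forall u : monom, low_mon k u -> f u = 0.

Lemma low_mon_sub k (u v : monom) : (forall x, (v x <= u x)%N) -> low_mon k u -> low_mon k v.
Proof.
move=> vu /andP[wu su]; rewrite /low_mon (mon_width_sub vu wu) /=.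
by apply: leq_ltn_trans su; apply: leq_sum.
Qed.

Lemma vanishD k f g : vanish k f -> vanish k g -> vanish k (f + g).
Proof. by move=> hf hg u ku; rewrite fpsDE hf // hg // addr0. Qed.

Lemma vanishN k f : vanish k f -> vanish k (- f).
Proof. by move=> hf u ku; rewrite fpsNE hf // oppr0. Qed.

Lemma vanishMl k f g : vanish k g -> vanish k (f * g).
Proof.
move=> hg u ku; rewrite fpsME big1 // => v _; rewrite hg ?mulr0 //.
by apply: low_mon_sub ku => x; rewrite msetE2 leq_subr.
Qed.

Lemma vanishMr k f g : vanish k f -> vanish k (f * g).
Proof. by move=> hf; rewrite mulrC; apply: vanishMl. Qed.

Lemma vanishV k f g : f \is a GRing.unit -> vanish k (f * g) -> vanish k g.
Proof. by move=> uf /(vanishMl f^-1); rewrite mulKr. Qed.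

(** Equality after the variables of index at least [n] are set to 0, see [eqtruncE] and
    [eqtruncP]. *)
Definition eqtrunc f g := forall k, vanish k (f - g).

Lemma eqtrunc_refl f : eqtrunc f f.
Proof. by move=> k; rewrite subrr. Qed.

Lemma eqtrunc_trans f g h : eqtrunc f g -> eqtrunc g h -> eqtrunc f h.
Proof.
by move=> fg gh k; rewrite -[f - h](subrKA g); apply: vanishD.
Qed.

Lemma eqtrunc_sym f g : eqtrunc f g -> eqtrunc g f.
Proof. by move=> fg k; rewrite -opprB; apply: vanishN. Qed.

Lemma eqtruncM f f' g g' : eqtrunc f f' -> eqtrunc g g' -> eqtrunc (f * g) (f' * g').
Proof.
move=> ff gg k; have -> : f * g - f' * g' = (f - f') * g + f' * (g - g') by ring.
by apply: vanishD; [apply: vanishMr | apply: vanishMl].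
Qed.

Lemma eqtrunc_prod1 I (r : seq I) (P : pred I) (F : I -> fps R) :
  (forall i, P i -> eqtrunc (F i) 1) -> eqtrunc (\prod_(i <- r | P i) F i) 1.
Proof.
move=> h; apply: (big_ind (fun f => eqtrunc f 1)) => //; first exact: eqtrunc_refl.
by move=> f g f1 g1; rewrite -[1]mulr1; apply: eqtruncM.
Qed.

Lemma eqtruncE f g (u : monom) : eqtrunc f g -> (mon_width u <= n)%N -> f u = g u.
Proof.
move=> fg un; apply/eqP; rewrite -subr_eq0; apply/eqP.
have := fg (\sum_(i < n) u i).+1 u; rewrite fpsDE fpsNE; apply.
by rewrite /low_mon un /=.
Qed.

Lemma eqtruncP f g : (forall u : monom, (mon_width u <= n)%N -> f u = g u) -> eqtrunc f g.
Proof. by move=> h k u /andP[un _]; rewrite fpsDE fpsNE h // subrr. Qed.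

Lemma eqtrunc_div1 f d : d \is a GRing.unit -> eqtrunc f 1 -> eqtrunc d 1 -> eqtrunc (f / d) 1.
Proof.
move=> ud f1 d1 k; apply: (vanishV ud); rewrite mulrBr mulr1 mulrCA divrr // mulr1.
exact: eqtrunc_trans f1 (eqtrunc_sym d1) k.
Qed.

Lemma eqtrunc1D f : (forall k, vanish k f) -> eqtrunc (1 + f) 1.
Proof. by move=> h k; rewrite addrAC subrr add0r. Qed.

Lemma vanish_fpsX k i : (n <= i)%N -> vanish k (fpsX R i).
Proof.
move=> ni u /andP[un _]; rewrite /fpsX; case: eqP => // ui.
have : (i < mon_width u)%N by apply: mon_width_lt; rewrite ui msetnxx.
by rewrite ltnNge (leq_trans un ni).
Qed.

End Ideal.

(** A monomial of width [n] does not see the factors outside [S n], so its coefficient is read off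
    the product over [S n]. Different widths are compared on the union of their index sets. *)
Lemma has_prod_trunc (R : comUnitRingType) (I : choiceType) (F : I -> fps R)
    (S : nat -> {fset I}) :
  (forall n i, i \notin S n -> eqtrunc n (F i) 1) ->
  exists2 P : fps R, has_prod F P & forall n, eqtrunc n P (\prod_(i <- S n) F i).
Proof.
move=> h; pose P : fps R := fun m => (\prod_(i <- S (mon_width m)) F i) m.
have hP n (A : {fset I}) : (S n `<=` A)%fset ->
    eqtrunc n (\prod_(i <- A) F i) (\prod_(i <- S n) F i).
  move=> SA; rewrite (big_fsetID _ (mem (S n))) /= -[X in eqtrunc _ _ X]mulr1.
  have -> : [fset x in A | x \in S n]%fset = S n.
    by apply/fsetP => i; rewrite !inE /= andb_idl //; apply: (fsubsetP SA).
  apply: eqtruncM; first exact: eqtrunc_refl.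
  rewrite big_seq; apply: eqtrunc_prod1 => i; rewrite !inE => /andP[_]; exact: h.
exists P; first by move=> m; exists (S (mon_width m)) => B SB; apply: eqtruncE (hP _ _ SB) _.
move=> n; apply: eqtruncP => u un; pose A := (S n `|` S (mon_width u))%fset.
rewrite -(eqtruncE (hP n A (fsubsetUl _ _)) un).
by apply/esym/(eqtruncE (hP _ A (fsubsetUr _ _))).
Qed.

(** * Polynomials in n variables as power series *)

Section Iota.
Variables (R : idomainType) (n : nat).
Implicit Types p : {mpoly R[n]}.

Definition mpoly_fps : {mpoly R[n]} -> fps R :=
  mmap (GRing.in_alg (fps R)) (fun i : 'I_n => fpsX R i).

HB.instance Definition _ := GRing.RMorphism.copy mpoly_fps
  (mmap (GRing.in_alg (fps R)) (fun i : 'I_n => fpsX R i)).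

Lemma mpoly_fpsX (i : 'I_n) : mpoly_fps 'X_i = fpsX R i.
Proof. by rewrite /mpoly_fps mmapX mmap1U. Qed.

Lemma mpoly_fpsZ c p : mpoly_fps (c *: p) = c *: mpoly_fps p.
Proof. by rewrite /mpoly_fps mmapZ /= mulr_algl. Qed.

(** A monomial given by the list of its variables with repetition, so that multiplication is
    concatenation. *)
Definition fps_mon (s : seq nat) : fps R := fun u => (u == seq_mset s)%:R.

Lemma fps_monM s1 s2 : fps_mon s1 * fps_mon s2 = fps_mon (s1 ++ s2).
Proof.
apply: boolp.funext => u; rewrite fpsME /fps_mon.
have cat : seq_mset (s1 ++ s2) = (seq_mset s1 `+` seq_mset s2)%mset.
  by apply/msetP => x; rewrite msetE2 !mset_seqE count_cat.
rewrite cat; have [s1u|s1u] := boolP (seq_mset s1 `<=` u)%mset; last first.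
  rewrite big_seq big1 => [|v]; last first.
    rewrite mon_divisorsP => vu; case: eqP => [e|_]; last by rewrite mul0r.
    by rewrite -e vu in s1u.
  case: eqP => // e; case/negP: s1u; rewrite e.
  by apply/msubsetP => x; rewrite msetE2 leq_addr.
rewrite (big_rem (seq_mset s1)) /= ?mon_divisorsP // eqxx mul1r big_seq big1 ?addr0.
  congr ((nat_of_bool _)%:R); apply/eqP/eqP => [<-|->]; last by rewrite msetDKB.
  by rewrite msetBDKC.
move=> v; rewrite mem_rem_uniq ?fset_uniq // inE => /andP[/negPf-> _].
by rewrite mul0r.
Qed.

Lemma fps_mon_nil : fps_mon [::] = 1.
Proof.
apply: boolp.funext => u; rewrite fps1E /fps_mon; congr ((nat_of_bool (_ == _))%:R).
by apply/msetP => x; rewrite mset_seqE mset0E.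
Qed.

Lemma fps_mon_fpsX i k : fpsX R i ^+ k = fps_mon (nseq k i).
Proof.
elim: k => [|k IH]; first by rewrite expr0 fps_mon_nil.
have e1 : fpsX R i = fps_mon [:: i].
  apply: boolp.funext => u; rewrite /fpsX /fps_mon; congr ((nat_of_bool (_ == _))%:R).
  by apply/msetP => x; rewrite mset_seqE /= addn0 msetnE eq_sym; case: eqP.
rewrite exprS IH e1; exact: (fps_monM [:: i]).
Qed.

Definition mon_seq (m : 'X_{1..n}) : seq nat :=
  flatten [seq nseq (m i) (i : nat) | i <- enum 'I_n].

Lemma mpoly_fps_monom m : mpoly_fps 'X_[m] = fps_mon (mon_seq m).
Proof.
rewrite /mpoly_fps mmapX /mmap1 /mon_seq -big_enum /=.
elim: (enum 'I_n) => [|i s IH] /=.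
  by rewrite big_nil fps_mon_nil.
rewrite big_cons IH fps_mon_fpsX; exact: fps_monM.
Qed.

Lemma count_mon_seq m (i : 'I_n) : count_mem (i : nat) (mon_seq m) = m i.
Proof.
rewrite /mon_seq count_flatten -map_comp sumnE big_map big_enum (bigD1 i) //=.
rewrite count_nseq /= eqxx mul1n big1 ?addn0 // => j ji.
by rewrite count_nseq /= (inj_eq val_inj) (negPf ji).
Qed.

Lemma mpoly_fps_coef p (u : monom) : (mon_width u <= n)%N ->
  mpoly_fps p u = p@_[multinom u (i : nat) | i < n].
Proof.
move=> un; rewrite [p in LHS]mpolyE rmorph_sum fps_sumE /= [in RHS](mpolyE p) raddf_sum /=.
apply: eq_bigr => m _; rewrite mpoly_fpsZ fpsZE mpoly_fps_monom [RHS]mcoeffZ mcoeffX.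
congr (_ * (nat_of_bool _)%:R); apply/eqP/eqP => [->|mE].
  by apply/mnmP => i; rewrite mnmE mset_seqE count_mon_seq.
apply/msetP => x; rewrite mset_seqE; case: (ltnP x n) => [xn|nx].
  by rewrite (count_mon_seq m (Ordinal xn)) mE mnmE.
have /eqP-> : u x == 0%N.
  rewrite -leqn0 leqNgt; apply/negP => /mon_width_lt; apply/negP; rewrite -leqNgt.
  exact: leq_trans un nx.
apply/esym/count_memPn; apply/flattenP => -[s /mapP[i _ ->]].
by rewrite mem_nseq => /andP[_ /eqP xi]; rewrite xi leqNgt ltn_ord in nx.
Qed.

Lemma vanish_mpoly_fps k p : order_ge k p -> vanish n k (mpoly_fps p).
Proof.
move=> pk u /andP[un uk]; rewrite mpoly_fps_coef // (order_ge_coef pk) //.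
by rewrite mdegE; under eq_bigr do rewrite mnmE.
Qed.

End Iota.

(** * Rogers-Szego polynomials *)

Section RogersSzegoRs.
Variables (F : fieldType) (t : F).
Hypothesis t_gen : forall k, (0 < k)%N -> 1 - t ^+ k != 0.

Lemma tpochS m : tpoch t m.+1 = tpoch t m * (1 - t ^+ m.+1).
Proof. by rewrite /tpoch big_nat_recr. Qed.

Lemma tpoch0 : tpoch t 0 = 1.
Proof. by rewrite /tpoch big_geq. Qed.

Lemma tpoch_neq0 m : tpoch t m != 0.
Proof. by elim: m => [|m IH]; rewrite ?tpoch0 ?oner_eq0 // tpochS mulf_neq0 ?t_gen. Qed.

Lemma tbinom0 m : tbinom t m 0 = 1.
Proof. by rewrite /tbinom subn0 tpoch0 mul1r divff ?tpoch_neq0. Qed.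

Lemma tbinomn m : tbinom t m m = 1.
Proof. by rewrite /tbinom subnn tpoch0 mulr1 divff ?tpoch_neq0. Qed.

Lemma tbinom_sub m k : (k <= m)%N -> tbinom t m (m - k) = tbinom t m k.
Proof. by move=> km; rewrite /tbinom subKn // [tpoch t (m - k) * _]mulrC. Qed.

Lemma tbinomS m k : (k < m)%N ->
  tbinom t m.+1 k.+1 = tbinom t m k + t ^+ k.+1 * tbinom t m k.+1.
Proof.
move=> km; have [j mE] : exists j, m = (k.+1 + j)%N by exists (m - k.+1)%N; rewrite subnKC.
have e1 : (m.+1 - k.+1 = j.+1)%N by rewrite mE subSS addSnnS addKn.
have e2 : (m - k = j.+1)%N by rewrite mE addSnnS addKn.
have e3 : (m - k.+1 = j)%N by rewrite mE addKn.
rewrite /tbinom e1 e2 e3 !tpochS.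
have -> : t ^+ m.+1 = t ^+ k.+1 * t ^+ j.+1 by rewrite -exprD mE addnS.
field; rewrite !tpoch_neq0 /=.
by rewrite !t_gen.
Qed.

(** The recursion of [rs] is the t-Pascal rule [tbinomS]. *)
Lemma rs_tbinom m al be :
  rs t m al be = \sum_(k < m.+1) al ^+ (m - k) * be ^+ k * tbinom t m k.
Proof.
elim: m be => [|m IH] be; first by rewrite big_ord1 tbinom0 !mulr1.
rewrite [LHS]/= !IH [RHS]big_ord_recl [X in _ = _ + X]big_ord_recr /=.
rewrite [X in be * X]big_ord_recr [X in al * X]big_ord_recl /= !tbinom0 !tbinomn.
have -> : \sum_(i < m) al ^+ (m.+1 - bump 0 i) * be ^+ bump 0 i * tbinom t m.+1 (bump 0 i) =
  be * (\sum_(i < m) al ^+ (m - i) * be ^+ i * tbinom t m i) +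
  al * (\sum_(i < m) al ^+ (m - bump 0 i) * (t * be) ^+ bump 0 i * tbinom t m (bump 0 i)).
  rewrite !mulr_sumr -big_split; apply: eq_bigr => i _ /=.
  rewrite /bump leq0n add1n tbinomS // subSS exprMn.
  have -> : (m - i = (m - i.+1).+1)%N by rewrite subnSK.
  by rewrite !exprS; ring.
rewrite /bump leq0n add1n !subnn !subn0 !expr0 !exprS; ring.
Qed.

Lemma RogersSzegoH_rs m z : RogersSzegoH m z t = rs t m z 1.
Proof.
rewrite rs_tbinom /RogersSzegoH (reindex_inj rev_ord_inj) /=.
apply: eq_bigr => k _; have km : (k <= m)%N by rewrite -ltnS.
by rewrite subSS tbinom_sub // expr1n mulr1.
Qed.

Lemma RogersSzegoH_div m a b : a != 0 -> a ^+ m * RogersSzegoH m (b / a) t = rs t m a b.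
Proof.
move=> a0; rewrite rs_tbinom /RogersSzegoH mulr_sumr; apply: eq_bigr => k _.
have km : (k <= m)%N by rewrite -ltnS.
rewrite mulrA; congr (_ * _); rewrite -{1}(subnK km) exprD expr_div_n; field.
by rewrite expf_neq0.
Qed.

End RogersSzegoRs.

Lemma RogersSzegoh_filter (F : fieldType) (P : pred nat) (la : seq nat) (z t : F) :
  RogersSzegoh [seq i <- la | P i] z t =
  \prod_(i <- undup la | P i) RogersSzegoH (count_mem i la) z t.
Proof.
rewrite /RogersSzegoh -filter_undup big_filter; apply: eq_bigr => i Pi.
rewrite count_filter; congr (RogersSzegoH _ z t); apply: eq_count => j /=.
by case: eqVneq => // ->; rewrite Pi.
Qed.

Lemma expr_size_filter (R : comPzSemiRingType) (P : pred nat) (la : seq nat) (a : R) :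
  a ^+ size [seq i <- la | P i] = \prod_(i <- undup la | P i) a ^+ count_mem i la.
Proof.
transitivity (\prod_(i <- [seq i <- la | P i]) a); first by rewrite big_const_seq count_predT iter_mulr_1.
rewrite -big_undup_iterop_count /= -filter_undup big_filter; apply: eq_bigr => i Pi.
rewrite count_filter; congr (_ ^+ _); apply: eq_count => j /=.
by case: eqVneq => // ->; rewrite Pi.
Qed.

(** The constant coefficient is 1. This makes all the divisions in [tbinom] genuine. *)
Lemma vt_gen k : (0 < k)%N -> 1 - tofrac vt ^+ k != 0.
Proof.
move=> k0; rewrite -(rmorph1 (@tofrac Zabt)) -rmorphXn -rmorphB tofrac_eq0 /vt.
apply/eqP => /(congr1 (mcoeff 0%MM))/eqP.
rewrite mcoeffB mcoeff1 eqxx mcoeffXn mcoeff0.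
have -> : (U_(@Ordinal 3 2 isT) *+ k == 0 :> 'X_{1..3})%MM = false.
  by rewrite -mdeg_eq0 mdegMn mdeg1 mul1n eqn0Ngt k0.
by rewrite subr0 oner_eq0.
Qed.

Lemma va_neq0 : tofrac va != 0.
Proof.
rewrite tofrac_eq0; apply/eqP => /(congr1 (mcoeff U_(@Ordinal 3 0 isT)%MM))/eqP.
by rewrite mcoeffXU eqxx mcoeff0 oner_eq0.
Qed.

(** The distinct parts are separated by parity. Each odd part of multiplicity m receives its share
    a^m of the power of a, which clears the denominator of H_m(b/a; t). *)
Lemma part_coef_RogersSzego (la : intpart) :
  tofrac (part_coef vt va vb (val la)) =
    tofrac va ^+ size (odd_parts (val la))
    * RogersSzegoh (even_parts (val la)) (tofrac va * tofrac vb) (tofrac vt)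
    * RogersSzegoh (odd_parts (val la)) (tofrac vb / tofrac va) (tofrac vt).
Proof.
rewrite /even_parts /odd_parts !RogersSzegoh_filter expr_size_filter.
rewrite [RHS]mulrAC -big_split /part_coef rmorph_prod (bigID odd) /=.
congr (_ * _); rewrite big_seq_cond [RHS]big_seq_cond; apply: eq_bigr => l.
  case/andP=> _ ol; rewrite RogersSzegoH_div; last exact: va_neq0.
    by rewrite /level_coef ol; case: l ol => // l _; rewrite (rs_rmorph (@tofrac Zabt)).
  exact: vt_gen.
case/andP=> lla el; have l0 : l != 0%N.
  have /andP[_ la0] := valP la; apply: contraNneq la0 => <-.
  by rewrite mem_undup in lla.
rewrite RogersSzegoH_rs; last exact: vt_gen.
rewrite /level_coef (negPf el); case: l l0 {lla el} => // l _.
by rewrite (rs_rmorph (@tofrac Zabt)) /= tofracM tofrac1.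
Qed.

(** * The infinite products *)

Lemma prod_divK (R : comUnitRingType) (I : Type) (r : seq I) (f d : I -> fps R) :
  (forall i, d i \is a GRing.unit) ->
  (\prod_(i <- r) d i) * (\prod_(i <- r) (f i / d i)) = \prod_(i <- r) f i.
Proof.
by move=> ud; rewrite -big_split; apply: eq_bigr => i _ /=; rewrite mulrCA divrr ?mulr1.
Qed.

Lemma fps_unit_coef0 (R : comUnitRingType) (f : fps R) :
  f mset0 = 1 -> f \is a GRing.unit.
Proof. by move=> f0; rewrite fps_unitE f0 unitr1. Qed.

Lemma fpsX_coef0 (R : comUnitRingType) i : fpsX R i mset0 = 0.
Proof.
rewrite /fpsX; case: eqP => // /msetP/(_ i).
by rewrite mset0E msetnxx.
Qed.

Section Factors.
Variables (R : comUnitRingType) (t a b : R).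
Local Notation X := (fpsX R).
Local Notation pairs := {p : nat * nat | (p.1 < p.2)%N}.

Definition numA i : fps R := (1 + a *: X i) * (1 + b *: X i).
Definition denA i : fps R := (1 - X i) * (1 + X i).
Definition numB (p : nat * nat) : fps R := 1 - t *: (X p.1 * X p.2).
Definition denB (p : nat * nat) : fps R := 1 - X p.1 * X p.2.

Lemma denA_unit i : denA i \is a GRing.unit.
Proof.
apply: fps_unit_coef0; rewrite /denA fpsM0E !fpsDE fpsNE fps1E eqxx fpsX_coef0.
by rewrite subr0 addr0 mulr1.
Qed.

Lemma denB_unit p : denB p \is a GRing.unit.
Proof.
apply: fps_unit_coef0; rewrite /denB fpsDE fpsNE fpsM0E fps1E eqxx !fpsX_coef0.
by rewrite mulr0 subr0.
Qed.

Lemma vanishZ n k (c : R) f : vanish n k f -> vanish n k (c *: f).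
Proof. by move=> h u ku; rewrite fpsZE h // mulr0. Qed.

Lemma factorA_trunc n i : (n <= i)%N -> eqtrunc n (numA i / denA i) 1.
Proof.
move=> ni; have v k : vanish n k (X i) by exact: vanish_fpsX.
apply: eqtrunc_div1; first exact: denA_unit.
  rewrite -[1]mulr1; apply: eqtruncM; apply: eqtrunc1D => k; exact: vanishZ.
rewrite -[1]mulr1; apply: eqtruncM; apply: eqtrunc1D => k //; exact: vanishN.
Qed.

Lemma factorB_trunc n p : (n <= p.2)%N -> eqtrunc n (numB p / denB p) 1.
Proof.
move=> np; have v k : vanish n k (X p.1 * X p.2) by apply/vanishMl/vanish_fpsX.
apply: eqtrunc_div1; first exact: denB_unit.
  by apply: eqtrunc1D => k; apply/vanishN/vanishZ.
by apply: eqtrunc1D => k; apply: vanishN.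
Qed.

Definition below n : {fset nat} := [fset nat_of_ord i | i : 'I_n]%fset.

Lemma in_below n i : (i \in below n) = (i < n)%N.
Proof.
apply/imfsetP/idP => [[j _ ->] //=|lt_in].
by exists (Ordinal lt_in).
Qed.

Lemma prod_below n (F : nat -> fps R) : \prod_(i <- below n) F i = \prod_(i < n) F i.
Proof.
by rewrite big_imfset /= ?big_enum //; move=> i j _ _ /val_inj.
Qed.

Definition pairs_below n : {fset pairs} :=
  [fset (exist (fun p : nat * nat => (p.1 < p.2)%N) (val (val q).1, val (val q).2) (valP q) : pairs)
     | q : {q : 'I_n * 'I_n | (q.1 < q.2)%N}]%fset.

Lemma notin_pairs_below n p : p \notin pairs_below n -> (n <= (val p).2)%N.
Proof.
apply: contraR; rewrite -ltnNge; case: p => -[i j] /= ij jn.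
apply/imfsetP => /=.
exists (exist (fun q : 'I_n * 'I_n => (q.1 < q.2)%N)
  (Ordinal (ltn_trans ij jn), Ordinal jn) ij) => //.
exact: val_inj.
Qed.

Lemma prod_pairs_below n (F : nat * nat -> fps R) :
  \prod_(p <- pairs_below n) F (val p) =
  \prod_(i < n) \prod_(j < n | (i < j)%N) F (i : nat, j : nat).
Proof.
rewrite big_imfset /=; last first.
  move=> [[i j] ij] [[i' j'] ij'] _ _ /(congr1 val) /= [/val_inj ei /val_inj ej].
  by apply: val_inj; rewrite /= ei ej.
rewrite big_enum /= pair_big_dep /=.
rewrite (big_sub [pred q : 'I_n * 'I_n | (q.1 < q.2)%N] (fun q => F (val q.1, val q.2))).
by [].
Qed.

End Factors.

Lemma two_neq0_Zabt : 2%:R != 0 :> Zabt.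
Proof. by rewrite -mpolyC_nat mpolyC_eq0. Qed.

Section FiniteProducts.
Variables (R : idomainType) (n : nat) (t a b : R).

Lemma mpoly_fps_num : mpoly_fps (prod_num n t a b) =
  (\prod_(i < n) numA a b i) *
  \prod_(i < n) \prod_(j < n | (i < j)%N) numB t (i : nat, j : nat).
Proof.
rewrite [LHS]rmorphM !rmorph_prod; congr (_ * _); apply: eq_bigr => i _.
  by rewrite /numA [LHS]rmorphM !rmorphD !rmorph1 /= !mpoly_fpsZ mpoly_fpsX.
rewrite rmorph_prod; apply: eq_bigr => j _.
by rewrite /numB rmorphB rmorph1 /= mpoly_fpsZ rmorphM /= !mpoly_fpsX.
Qed.

Lemma mpoly_fps_den : mpoly_fps (prod_den n R) =
  (\prod_(i < n) denA R i) *
  \prod_(i < n) \prod_(j < n | (i < j)%N) denB R (i : nat, j : nat).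
Proof.
rewrite [LHS]rmorphM !rmorph_prod; congr (_ * _); apply: eq_bigr => i _.
  by rewrite /denA [LHS]rmorphM rmorphB rmorphD !rmorph1 /= mpoly_fpsX.
rewrite rmorph_prod; apply: eq_bigr => j _.
by rewrite /denB rmorphB rmorph1 /= rmorphM /= !mpoly_fpsX.
Qed.

Lemma mpoly_fps_den_unit : mpoly_fps (prod_den n R) \is a GRing.unit.
Proof.
rewrite mpoly_fps_den unitrM; apply/andP; split; apply: rpred_prod => i _.
  exact: denA_unit.
by apply: rpred_prod => j _; apply: denB_unit.
Qed.

Lemma mpoly_fps_den_num :
  mpoly_fps (prod_den n R) *
    ((\prod_(i <- below n) (numA a b i / denA R i)) *
     (\prod_(p <- pairs_below n) (numB t (val p) / denB R (val p)))) =
  mpoly_fps (prod_num n t a b).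
Proof.
rewrite mpoly_fps_num mpoly_fps_den -!prod_below.
rewrite -!(prod_pairs_below n) mulrACA !prod_divK //.
- by move=> p; apply: denB_unit.
- exact: denA_unit.
Qed.

End FiniteProducts.

(* The scalar a^l(lambda_o) h_{lambda_e}(ab;t) h_{lambda_o}(b/a;t), computed in
   the fraction field of Z[a, b, t], is the image of a polynomial [c lambda];
   the identity itself lives in Z[a, b, t][[x]]. *)
Theorem theorem1p1 :
  exists (c : intpart -> Zabt) (A B : fps Zabt),
  [/\ forall la : intpart,
        tofrac (c la) =
          tofrac va ^+ size (odd_parts (val la))
          * RogersSzegoh (even_parts (val la)) (tofrac va * tofrac vb) (tofrac vt)
          * RogersSzegoh (odd_parts (val la)) (tofrac vb / tofrac va) (tofrac vt),
      has_prod
        (fun i : nat =>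
           ((1 + va *: fpsX Zabt i) * (1 + vb *: fpsX Zabt i))
           / ((1 - fpsX Zabt i) * (1 + fpsX Zabt i))) A,
      has_prod
        (fun p : {p : nat * nat | (p.1 < p.2)%N} =>
           (1 - vt *: (fpsX Zabt (val p).1 * fpsX Zabt (val p).2))
           / (1 - fpsX Zabt (val p).1 * fpsX Zabt (val p).2)) B
    & has_sum (fun la : intpart => c la *: HallLittlewoodP (val la) vt) (A * B)].
Proof.
(* Each infinite product comes with its truncations: a factor involving a variable of index at least
   [n] is 1 after truncation to [n] variables. *)
have [A hA eA] := @has_prod_trunc _ _ (fun i => numA va vb i / denA Zabt i) below
  (fun n i ni => factorA_trunc va vb (etrans (leqNgt n i) (etrans (congr1 negb (esym (in_below n i))) ni))).
have [B hB eB] := @has_prod_trunc _ _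
  (fun p : {p : nat * nat | (p.1 < p.2)%N} => numB vt (val p) / denB Zabt (val p)) pairs_below
  (fun n p np => factorB_trunc vt (notin_pairs_below np)).
exists (fun la => part_coef vt va vb (val la)), A, B; split => // [la|m].
  exact: part_coef_RogersSzego.
(* The coefficient at [m] needs [n] variables and precision beyond its degree [k]; the order
   [2 * k.+1] has the form provided by [sum_shapes_order]. *)
pose n := mon_width m; pose k := (\sum_(i < n) m i)%N.
exists (shapes n (2 * k.+1)) => C SC.
pose u := [multinom m (i : nat) | i < n].
have mdeg_u : (mdeg u < 2 * k.+1)%N.
  rewrite mdegE; under eq_bigr do rewrite mnmE.
  by rewrite -/k mulnS addnC addn2 ltnS (leq_trans _ (leqnSn _)) // leq_pmull.
(* A partition outside [shapes] has more than [n] parts, and its polynomial is 0, or a part above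
   [2 * k.+1], and its polynomial has order above the degree of [m]. *)
rewrite fps_sumE -(big_fset_incl _ SC) /=; last first.
  move=> la _ la_out; rewrite fpsZE /HallLittlewoodP -/n -/u.
  have [sla|sla] := leqP (size (val la)) n; last first.
    have -> : hl_poly n (val la) vt = 0; last by rewrite mcoeff0 mulr0.
    apply/eqP; rewrite -tofrac_eq0 hl_poly_frac; last exact: two_neq0_Zabt.
    by rewrite /hl_rat leqNgt sla.
  have : ~~ all (fun j => (j < (2 * k.+1).+1)%N) (val la).
    by apply: contra la_out; apply: mem_shapes.
  move/(hl_poly_order n vt two_neq0_Zabt)/order_ge_coef => ->; first by rewrite mulr0.
  exact: ltnW.
pose W := \sum_(la <- shapes n (2 * k.+1)) part_coef vt va vb (val la) *: hl_poly n (val la) vt.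
transitivity (mpoly_fps W m).
  rewrite mpoly_fps_coef // -/u raddf_sum; apply: eq_bigr => la _.
  by rewrite fpsZE [RHS]mcoeffZ.
have low : low_mon n (2 * k.+1) m.
  by rewrite /low_mon leqnn -/k mulnS addnC addn2 ltnS (leq_trans _ (leqnSn _)) // leq_pmull.
suff : vanish n (2 * k.+1) (mpoly_fps W - A * B).
  by move=> /(_ m low) /eqP; rewrite fpsDE fpsNE subr_eq0 => /eqP.
(* Multiplication by the invertible finite denominator reduces the claim to the polynomial
   congruence and to the truncations of [A] and [B]. *)
apply: (vanishV (mpoly_fps_den_unit Zabt n)).
have := vanish_mpoly_fps (sum_shapes_order n vt va vb two_neq0_Zabt k).
have AB := eqtruncM (eA n) (eB n).
move=> h; have -> : mpoly_fps (prod_den n Zabt) * (mpoly_fps W - A * B) =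
   mpoly_fps (prod_den n Zabt * W - prod_num n vt va vb) -
   mpoly_fps (prod_den n Zabt) * (A * B -
     (\prod_(i <- below n) (numA va vb i / denA Zabt i)) *
     (\prod_(p <- pairs_below n) (numB vt (val p) / denB Zabt (val p)))).
  rewrite [in RHS]mulrBr mpoly_fps_den_num rmorphB /= [mpoly_fps (_ * W)]rmorphM /=.
  by rewrite mulrBr opprB addrA subrK.
by apply: vanishD => //; apply/vanishN/vanishMl/AB.
Qed.
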